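(* For all positive integers $n$, $$\mathtt{SCG}(\beta(n,n,\infty))=\Omega\left(\frac{\beta(n,n,\infty)}{n\log n}\right).$$
   Context: Directed sparsest cut: given a directed graph $G=(V,E)$ and demand pairs $P\subseteq V\times V$, for an edge set $E'\subseteq E$ let $P_{E'}\subseteq P$ be the set of pairs $(s,t)$ with no $s\leadsto t$ path in $G\setminus E'$; $\textsc{SCut}(G,P)$ is the minimum of $|E'|/|P_{E'}|$ over $E'$ with $P_{E'}\neq\emptyset$. Maximum concurrent flow: with unit capacity on every edge, choose for each $(s_i,t_i)\in P$ a flow $f_i$ from $s_i$ to $t_i$ (conserved elsewhere) such that the total flow on each edge is at most $1$; $\textsc{MCFlow}(G,P)$ is the maximum over such choices of $\min_i|f_i|$, where $|f_i|$ is the value of $f_i$. $\mathtt{SCG}(N)$ is the least integer $k$ such that for every $N$-node directed graph $G$ and every set of demand pairs $P$ (of any size), $\textsc{SCut}(G,P)\le k\cdot\textsc{MCFlow}(G,P)$. A path system is $S=(V,\Pi)$ with $V$ a finite set of nodes and $\Pi$ a multiset of node sequences (paths), each containing each node at most once; size $\|S\|=\sum_\pi|\pi|$ ($|\pi|$ = number of nodes). Write $x<_\pi y$ if $x$ strictly precedes $y$ in $\pi$. A $b$-bridge: $b$ distinct nodes $v_1,\dots,v_b$ and $b$ distinct paths $\pi_1,\dots,\pi_b$ with $v_i<_{\pi_i}v_{i+1}$ ($1\le i\le b-1$) and $v_1<_{\pi_b}v_b$. Bridge girth = least $b$ admitting a $b$-bridge ($\infty$ if none). $\beta(n,p,k)$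 = maximum size of a path system with $n$ nodes, $p$ paths and bridge girth $>k$. *)

(* Defs.v *)
From HB Require Import structures.
From mathcomp Require Import all_boot all_order all_algebra.
From mathcomp Require Import boolp classical_sets reals exp.
Set Implicit Arguments. Unset Strict Implicit. Unset Printing Implicit Defensive.
Import Order.TTheory GRing.Theory Num.Theory.
Local Open Scope ring_scope.

(* Generic "least / greatest natural number with property P", via classical choice.
   If no such extremal element exists the value is 0 (this never happens for the
   uses below, where the extremum exists). *)
Definition least_nat (P : nat -> Prop) : nat :=
  match pselect (exists m, P m /\ forall k, P k -> (m <= k)%N) with
  | left h => proj1_sig (cid h)
  | right _ => 0%N
  end.

Definition greatest_nat (P : nat -> Prop) : nat :=
  match pselect (exists m, P m /\ forall k, P k -> (k <= m)%N) with
  | left h => proj1_sig (cid h)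
  | right _ => 0%N
  end.

(* Directed graphs on N nodes 'I_N, edge set E, demand pairs P.        *)

Section Graphs.
Variable N : nat.
Notation V := 'I_N.

Definition cut_pairs (E P E' : {set V * V}) : {set V * V} :=
  [set p in P | ~~ connect (fun x y => (x, y) \in E :\: E') p.1 p.2].

Variable R : realType.

Definition SCut (E P : {set V * V}) : R :=
  inf [set r : R | exists E' : {set V * V},
         [/\ E' \subset E, cut_pairs E P E' != finset.set0 &
             r = #|E'|%:R / #|cut_pairs E P E'|%:R]].

Definition out_flow (E : {set V * V}) (g : V * V -> R) (v : V) : R :=
  \sum_(e in E | e.1 == v) g e.
Definition in_flow (E : {set V * V}) (g : V * V -> R) (v : V) : R :=
  \sum_(e in E | e.2 == v) g e.

Definition is_flow (E : {set V * V}) (s t : V) (g : V * V -> R) : Prop :=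
  (forall e, e \in E -> 0 <= g e) /\
  (forall v, v != s -> v != t -> in_flow E g v = out_flow E g v).

Definition flow_value (E : {set V * V}) (s : V) (g : V * V -> R) : R :=
  out_flow E g s - in_flow E g s.

Definition feasible_mcf (E P : {set V * V}) (f : V * V -> V * V -> R) : Prop :=
  (forall p, p \in P -> is_flow E p.1 p.2 (f p)) /\
  (forall e, e \in E -> \sum_(p in P) f p e <= 1).

Definition is_min_value (E P : {set V * V}) (f : V * V -> V * V -> R) (r : R) : Prop :=
  (forall p, p \in P -> r <= flow_value E p.1 (f p)) /\
  (exists2 p, p \in P & r = flow_value E p.1 (f p)).

Definition MCFlow (E P : {set V * V}) : R :=
  sup [set r : R | exists f, feasible_mcf E P f /\ is_min_value E P f r].

End Graphs.

Definition SCG_bound (R : realType) (N k : nat) : Prop :=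
  forall (E P : {set 'I_N * 'I_N}),
    P != finset.set0 -> (forall p, p \in P -> p.1 != p.2) ->
    SCut R E P <= (k%:R : R) * MCFlow R E P.

Definition SCG (R : realType) (N : nat) : nat := least_nat (SCG_bound R N).

Definition prec (n : nat) (pi : seq 'I_n) (x y : 'I_n) : bool :=
  [&& x \in pi, y \in pi & (index x pi < index y pi)%N].

(* path system on node set 'I_n with the multiset of paths given by Pi *)
Definition is_path_system (n : nat) (Pi : seq (seq 'I_n)) : Prop :=
  all uniq Pi.

Definition ps_size (n : nat) (Pi : seq (seq 'I_n)) : nat := sumn (map size Pi).

(* a b-bridge: distinct nodes v_0..v_{b-1}, distinct paths (indices into the
   multiset Pi) q_0..q_{b-1}, with v_i <_{q_i} v_{i+1} for i < b-1 and
   v_0 <_{q_{b-1}} v_{b-1}. *)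
Definition has_bridge (n : nat) (Pi : seq (seq 'I_n)) (b : nat) : Prop :=
  exists (v : 'I_b -> 'I_n) (q : 'I_b -> nat),
    (0 < b)%N /\ [/\ injective v, injective q, (forall i, q i < size Pi)%N,
        (forall (i : 'I_b) (j : 'I_b), j = i.+1 :> nat ->
            prec (nth [::] Pi (q i)) (v i) (v j)) &
        (forall (i0 il : 'I_b), i0 = 0%N :> nat -> il = b.-1 :> nat ->
            prec (nth [::] Pi (q il)) (v i0) (v il))].

Definition bridge_free (n : nat) (Pi : seq (seq 'I_n)) : Prop :=
  forall b : nat, ~ has_bridge Pi b.

Definition beta_inf (n p : nat) : nat :=
  greatest_nat (fun m => exists Pi : seq (seq 'I_n),
    [/\ is_path_system Pi, size Pi = p, bridge_free Pi & ps_size Pi = m]).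

(* Main.v *)
Require Import Defs.
From HB Require Import structures.
From mathcomp Require Import all_boot all_order all_algebra.
From mathcomp Require Import boolp classical_sets reals exp.
From mathcomp Require Import zify ring lra.
Import Order.TTheory GRing.Theory Num.Theory.
Local Open Scope ring_scope.
Set Implicit Arguments. Unset Strict Implicit. Unset Printing Implicit Defensive.

(** Take a bridge-free system whose paths have the same length up to a factor 2
    (the choice of the dyadic length class costs the factor log n) and pass to a
    random subset of the nodes and to a subset of the paths so that the union of
    the remaining paths is acyclic: repeatedly contracting a shortest cycle that
    runs through blocks of nodes joined by rainbow walks shows that discarding at
    most 2|V| paths suffices. In what is left, bridge-freeness says that a walk
    with both ends on a path pi uses only pi.

    Replace each node v by about C deg(v) + L parallel unit edges.  The demand of
    a path pi of length 2L has to climb through L states, and the edge for state c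
    at v is the copy with index c + o(pi, v).  The potential argument shows that
    every route from s_pi to t_pi uses at least L copies, so the total number of
    copies bounds the concurrent flow by a constant.  A greedy route passes every
    node of pi whose copy for the current state is not cut; so disconnecting pi
    requires at least L cut copies on it.  For random offsets o, simultaneously for
    all choices of demands and blocked nodes, the blocked copies collide so rarely
    that cutting j demands takes at least jL/2 edges.

    If beta is too small for this to apply, the lines x |-> (x, b + x a, c + x a^2)
    in a grid serve as the path system. *)

(** * Attained extrema of sets of natural numbers *)

Lemma least_natP (P : nat -> Prop) : (exists k, P k) -> P (least_nat P).
Proof.
move=> [k Pk]; rewrite /least_nat; case: pselect => [h|[]].
  by case: (cid h) => m [].
have ex : exists k, `[<P k>] by exists k; apply/asboolP.
case: (ex_minnP ex) => m /asboolP Pm mmin; exists m; split=> // j Pj.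
by apply: mmin; exact/asboolP.
Qed.

Lemma greatest_natP (P : nat -> Prop) (b : nat) :
  (exists k, P k) -> (forall k, P k -> (k <= b)%N) -> 
  P (greatest_nat P) /\ forall k, P k -> (k <= greatest_nat P)%N.
Proof.
move=> [k Pk] Pb; rewrite /greatest_nat; case: pselect => [h|[]].
  by case: (cid h) => m [].
have ex : exists k, `[<P k>] by exists k; apply/asboolP.
have ub i : `[<P i>] -> (i <= b)%N by move/asboolP; exact: Pb.
case: (ex_maxnP ex ub) => m /asboolP Pm mmax; exists m; split=> // j Pj.
by apply: mmax; exact/asboolP.
Qed.

(** * Concurrent flow and sparsest cut: bounds from routings and potentials *)

Section Flows.
Variables (R : realType) (N : nat).
Local Notation V := 'I_N.
Implicit Types (E P : {set V * V}).

Lemma flow_le_sum E s (g : V * V -> R) :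
  (forall e, e \in E -> 0 <= g e) -> flow_value E s g <= \sum_(e in E) g e.
Proof.
move=> g0; rewrite /flow_value /out_flow /in_flow.
rewrite [X in _ <= X](bigID (fun e => e.1 == s)) /=.
rewrite lerD2l; apply: (@le_trans _ _ 0).
  by rewrite oppr_le0; apply: sumr_ge0 => e /andP[/g0].
by apply: sumr_ge0 => e /andP[/g0].
Qed.

(** Makes the [sup] in [MCFlow] a genuine supremum: one flow value is at most its total load, and
    capacity 1 bounds the load by the number of edges. *)
Lemma MCFlow_bounded E P :
  has_ubound [set r : R | exists f, feasible_mcf E P f /\ is_min_value E P f r].
Proof.
exists #|E|%:R => r [f [[ff fc] [_ [p pP ->]]]].
apply: le_trans (flow_le_sum _ (ff p pP).1) _.
apply: (@le_trans _ _ (\sum_(e in E) (1 : R))); last by rewrite sumr_const.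
apply: ler_sum => e eE; apply: le_trans (fc e eE).
rewrite (bigD1 p) //= lerDl; apply: sumr_ge0 => q /andP[qP _].
exact: (ff q qP).1.
Qed.

Lemma min_value_ex E P (f : V * V -> V * V -> R) :
  P != finset.set0 -> exists r, is_min_value E P f r.
Proof.
move/set0Pn => [p0 p0P].
case: (@Order.TotalTheory.arg_minP _ _ _ p0 (mem P) (fun p => flow_value E p.1 (f p)) p0P) => p pP pmin.
by exists (flow_value E p.1 (f p)); split=> //; exists p.
Qed.

Lemma MCFlow_ge E P (f : V * V -> V * V -> R) (x : R) :
  P != finset.set0 -> feasible_mcf E P f ->
  (forall p, p \in P -> x <= flow_value E p.1 (f p)) -> x <= MCFlow R E P.
Proof.
move=> P0 ff fx; have [r rm] := min_value_ex E f P0.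
have [p pP rE] := rm.2.
apply: (@le_trans _ _ r); first by rewrite rE fx.
by apply: ub_le_sup; [exact: MCFlow_bounded|exists f].
Qed.

Lemma zero_feasible E P : feasible_mcf E P (fun _ _ => 0 : R).
Proof.
split=> [p _|e _]; last by rewrite big1 ?ler01.
by split=> // v _ _; rewrite /in_flow /out_flow !big1.
Qed.

Lemma MCFlow_ge0 E P : P != finset.set0 -> 0 <= MCFlow R E P.
Proof.
move=> P0; apply: (MCFlow_ge P0 (zero_feasible E P)) => p pP.
by rewrite /flow_value /out_flow /in_flow !big1 ?subrr.
Qed.

Definition walk_flow (s : V) (w : seq V) (e : V * V) : nat :=
  count_mem e (zip (s :: w) w).

Lemma sum_edge_indicator E (a : pred (V * V)) (e0 : V * V) :
  e0 \in E -> (\sum_(e in E | a e) (e0 == e) = a e0)%N.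
Proof.
move=> e0E; case: (boolP (a e0)) => ae0.
  rewrite (bigD1 e0) /= ?e0E // eqxx big1 // => e /andP[_].
  by rewrite eq_sym => /negPf ->.
by rewrite big1 // => e /andP[_ ae]; case: eqP => // e0e; rewrite e0e ae in ae0.
Qed.

(** Flow conservation along a walk, in additive form because the counts are natural numbers. *)
Lemma walk_flow_balance E s w v :
  path (fun x y => (x, y) \in E) s w ->
  (\sum_(e in E | e.1 == v) walk_flow s w e + (v == last s w) =
   \sum_(e in E | e.2 == v) walk_flow s w e + (v == s))%N.
Proof.
elim: w s => [|x w IH] s /=.
  by move=> _; congr addn; rewrite !big1.
case/andP => sx px; have := IH x px; rewrite /walk_flow /= !big_split /=.
rewrite !sum_edge_indicator //= (eq_sym s) (eq_sym x v).
by case: w px {IH} => [|z w] _ /=; lia.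
Qed.

(** Route every demand along one walk and scale by the total length [m] of the walks, so that no
    edge overflows. *)
Lemma MCFlow_gt0 E P :
  P != finset.set0 -> (forall p, p \in P -> p.1 != p.2) ->
  (forall p, p \in P -> connect (fun x y => (x, y) \in E) p.1 p.2) ->
  0 < MCFlow R E P.
Proof.
move=> P0 Pd Pc.
have {}Pc p : exists w, p \in P ->
    path (fun x y => (x, y) \in E) p.1 w /\ p.2 = last p.1 w.
  case: (boolP (p \in P)) => [/Pc/connectP[w pw lw]|_]; last by exists [::].
  by exists w.
have [w wP] := choice Pc.
pose m : nat := \sum_(p in P) (size (w p)).+1.
have m0 : (0 < m)%N.
  by have [p pP] := set0Pn _ P0; rewrite /m (bigD1 p).
pose f (p e : V * V) : R := (walk_flow p.1 (w p) e)%:R / m%:R.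
have m0' : 0 < (m%:R : R) by rewrite ltr0n.
have sumE (a : pred (V * V)) p : \sum_(e in E | a e) f p e =
    (\sum_(e in E | a e) walk_flow p.1 (w p) e)%N%:R / m%:R.
  by rewrite /f -mulr_suml natr_sum.
apply: (@lt_le_trans _ _ (m%:R^-1)); first by rewrite invr_gt0.
apply: (MCFlow_ge P0 (f := f)).
  split=> [p pP|e eE].
    split=> [e _|v vs vt]; first by rewrite divr_ge0 ?ler0n.
    have [pw lw] := wP p pP.
    have := walk_flow_balance v pw.
    rewrite -lw (negPf vs) (negPf vt) !addn0 /in_flow /out_flow !sumE => ->.
    by [].
  rewrite /f -mulr_suml ler_pdivrMr // mul1r -natr_sum ler_nat.
  apply: leq_sum => p _; apply: leq_trans (count_size _ _) _.
  by rewrite size_zip geq_min /= leqnSn orbT.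
move=> p pP; have [pw lw] := wP p pP.
have := walk_flow_balance p.1 pw.
rewrite -lw eqxx (negPf (Pd p pP)) addn0 addn1 /flow_value /in_flow /out_flow !sumE => ->.
by rewrite -mulrBl -natrB // subSnn mul1r.
Qed.

Lemma SCut_le0 E P : 
  (exists2 p, p \in P & ~~ connect (fun x y => (x, y) \in E) p.1 p.2) ->
  SCut R E P <= 0.
Proof.
move=> [p pP pc]; apply: ge_inf; first by exists 0 => r [E' [_ _ ->]]; rewrite divr_ge0.
exists finset.set0; split; rewrite ?finset.sub0set ?cards0 ?mul0r //.
apply/set0Pn; exists p; rewrite inE pP /=; apply: contra pc.
by rewrite (eq_connect (e' := fun x y => (x, y) \in E)) // => x y; rewrite !inE.
Qed.

Lemma SCut_ge E P (x : R) :
  P != finset.set0 -> (forall p, p \in P -> p.1 != p.2) ->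
  (forall E' : {set V * V}, E' \subset E -> x * #|cut_pairs E P E'|%:R <= #|E'|%:R) -> x <= SCut R E P.
Proof.
move=> P0 Pd H; apply: lb_le_inf.
  (* A lower bound on [inf] needs a nonempty set: deleting all of [E] separates every demand, since
     its endpoints are distinct. *)
  exists (#|E|%:R / #|cut_pairs E P E|%:R), E; split=> //.
  have [p pP] := set0Pn _ P0; apply/set0Pn; exists p; rewrite inE pP /=.
  apply/negP => /connectP[[|z w]] /=; last by rewrite !inE andNb.
  by move=> _ /eqP; rewrite eq_sym (negPf (Pd p pP)).
move=> r [E' [sE c0 ->]].
by rewrite ler_pdivlMr ?H // ltr0n card_gt0.
Qed.

(** Weak duality: summed against [g], the increments of [phi] telescope by conservation to [phi t]
    times the value, and [phi] can rise only on [W], by at most 1 per edge. *)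
Lemma flow_potential E s t (g : V * V -> R) (W : {set V * V}) (phi : V -> R) :
  s != t -> is_flow E s t g -> W \subset E -> phi s = 0 ->
  (forall e, e \in E -> phi e.2 <= phi e.1 + (e \in W)%:R) ->
  phi t * flow_value E s g <= \sum_(e in W) g e.
Proof.
move=> st [g0 gc] WE phis phiE.
have sumv (F : V -> R) (pr : V * V -> V) : \sum_(e in E) F (pr e) * g e =
    \sum_v F v * \sum_(e in E | pr e == v) g e.
  rewrite (partition_big pr xpredT) //=; apply: eq_bigr => v _.
  by rewrite mulr_sumr; apply: eq_bigr => e /andP[_ /eqP ->].
(* Net inflows sum to zero over all nodes, so what leaves [s] arrives at [t]. *)
have tot : \sum_v (\sum_(e in E | e.2 == v) g e - \sum_(e in E | e.1 == v) g e) = 0.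
  have := sumv (fun=> 1) (fun e => e.2); have := sumv (fun=> 1) (fun e => e.1) => /= -> .
  under eq_bigr do rewrite mul1r; under [in X in _ = X -> _]eq_bigr do rewrite mul1r.
  by move=> E12; rewrite sumrB E12 subrr.
pose D v := in_flow E g v - out_flow E g v.
have D0 v : v != s -> v != t -> D v = 0 by move=> vs vt; rewrite /D gc // subrr.
have Dt : D t = flow_value E s g.
  have {}tot : \sum_v D v = 0 by [].
  move: tot; rewrite (bigD1 s) //= (bigD1 t) 1?eq_sym //= [X in _ + (_ + X)]big1.
    by rewrite /flow_value /D => ?; lra.
  by move=> v /andP[vs vt]; exact: D0.
have -> : phi t * flow_value E s g = \sum_(e in E) (phi e.2 - phi e.1) * g e.
  under eq_bigr do rewrite mulrBl.
  rewrite sumrB (sumv phi (fun e => e.2)) (sumv phi (fun e => e.1)) -sumrB.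
  rewrite (bigD1 t) //= (bigD1 s) //= phis !mul0r subrr add0r -mulrBr.
  rewrite -/(in_flow E g t) -/(out_flow E g t) -/(D t) Dt big1 ?addr0 //.
  move=> v /andP[vt vs].
  by rewrite -mulrBr -/(in_flow E g v) -/(out_flow E g v) -/(D v) D0 // mulr0.
apply: (@le_trans _ _ (\sum_(e in E) (e \in W)%:R * g e)).
  apply: ler_sum => e eE; apply: ler_wpM2r; first exact: g0.
  by rewrite lerBlDl phiE.
rewrite (bigID (mem W)) /= [X in _ + X]big1 ?addr0; last first.
  by move=> e /andP[_ /negPf ->]; rewrite mul0r.
rewrite le_eqVlt; apply/orP; left; apply/eqP.
apply: eq_big => [e|e /andP[_ ->]]; last by rewrite mul1r.
by case: (boolP (e \in W)) => [/(fintype.subsetP WE) ->|]; rewrite ?andbF.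
Qed.

(** Each of the [#|P|] flows of value [r] consumes at least [L * r] of the capacity of [W], which
    totals [#|W|]. *)
Lemma MCFlow_le E P (W : {set V * V}) (phi : V * V -> V -> R) (L : R) :
  P != finset.set0 -> (forall p, p \in P -> p.1 != p.2) -> W \subset E ->
  0 < L ->
  (forall p, p \in P -> phi p p.1 = 0 /\ phi p p.2 = L) ->
  (forall p e, p \in P -> e \in E -> phi p e.2 <= phi p e.1 + (e \in W)%:R) ->
  MCFlow R E P * (L * #|P|%:R) <= #|W|%:R.
Proof.
move=> P0 Pd WE L0 phi0 phiE.
have P0' : 0 < (#|P|%:R : R) by rewrite ltr0n card_gt0.
rewrite -ler_pdivlMr ?mulr_gt0 //; apply: ge_sup.
  have [r rm] := min_value_ex E (fun _ _ => 0 : R) P0.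
  by exists r, (fun _ _ => 0); split=> //; exact: zero_feasible.
move=> r [f [[ff fc] [rle _]]]; rewrite ler_pdivlMr ?mulr_gt0 //.
apply: (@le_trans _ _ (\sum_(p in P) \sum_(e in W) f p e)).
  rewrite [in leLHS]mulrA -sumr_const mulr_sumr; apply: ler_sum => p pP; rewrite mulr1.
  have [p1 p2] := phi0 p pP.
  have := flow_potential (Pd p pP) (ff p pP) WE p1 (fun e => phiE p e pP).
  apply: le_trans; rewrite p2 mulrC ler_pM2l //; exact: rle.
rewrite exchange_big /= -sumr_const; apply: ler_sum => e eW.
exact/fc/(fintype.subsetP WE).
Qed.

End Flows.

(** [SCG] is a true minimum because some bound exists. For one instance, either a demand is already
    disconnected and the cut value is at most 0, or the flow is positive. There are finitely many
    instances, so their bounds can be summed. *)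
Lemma SCG_boundP (R : realType) (N : nat) : SCG_bound R N (SCG R N).
Proof.
apply: least_natP.
have ex (EP : {set 'I_N * 'I_N} * {set 'I_N * 'I_N}) : exists k : nat,
    EP.2 != finset.set0 -> (forall p, p \in EP.2 -> p.1 != p.2) ->
    SCut R EP.1 EP.2 <= k%:R * MCFlow R EP.1 EP.2.
  case: EP => E P /=.
  have [P0|P0] := eqVneq P finset.set0; first by exists 0%N.
  have [[p pP pc]|H] := pselect (exists2 p, p \in P & ~~ connect (fun x y => (x, y) \in E) p.1 p.2).
    by exists 0%N => _ _; rewrite mul0r; apply: SCut_le0; exists p.
  have Pc p : p \in P -> connect (fun x y => (x, y) \in E) p.1 p.2.
    by move=> pP; apply/negPn/negP => pc; case: H; exists p.
  have [Pd|Pd] := pselect (forall p, p \in P -> p.1 != p.2); last by exists 0%N.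
  have F0 := MCFlow_gt0 R P0 Pd Pc.
  exists (Num.Def.archi_bound (`|SCut R E P| / MCFlow R E P)) => _ _.
  rewrite -ler_pdivrMr //; apply: ltW; apply: le_lt_trans (archi_boundP _).
    by apply: ler_wpM2r; [rewrite invr_ge0 ltW|exact: ler_norm].
  by rewrite divr_ge0 // ltW.
have [F FP] := choice ex.
exists (\sum_EP F EP)%N => E P P0 Pd.
apply: le_trans (FP (E, P) P0 Pd) _.
apply: ler_wpM2r; first exact: MCFlow_ge0.
by rewrite ler_nat (bigD1 (E, P)) //= leq_addr.
Qed.

(** * Random offsets and the exponential moment of the number of collisions *)

Section RandomOffsets.
Variables (X V : finType) (nd : X -> V) (M : V -> nat) (C : nat).
Hypothesis M_gt0 : forall v, (0 < M v)%N.
Hypothesis M_deg : forall v, (C * #|[set x | nd x == v]| <= M v)%N.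

(** A common multiple of all [M v]: a uniform residue modulo it is uniform modulo every [M v]. *)
Definition modulus : nat := \prod_v M v.
Local Notation K := modulus.
Local Notation Omega := {ffun X -> 'I_K}.

Lemma modulus_gt0 : (0 < K)%N.
Proof. exact: prodn_gt0. Qed.

Lemma dvdn_modulus v : (M v %| K)%N.
Proof. by rewrite /modulus (bigD1 v) //= dvdn_mulr. Qed.

Definition shifted_cell (st : X -> nat) (o : X -> nat) (x : X) : V * nat :=
  (nd x, (st x + o x) %% M (nd x))%N.

Definition repeats st o (s : seq X) : nat :=
  size s - size (undup [seq shifted_cell st o x | x <- s]).

Lemma repeats_cons st o x s :
  repeats st o (x :: s) =
  (repeats st o s + (shifted_cell st o x \in [seq shifted_cell st o z | z <- s]))%N.
Proof.
rewrite /repeats /=; have := size_undup [seq shifted_cell st o z | z <- s].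
by rewrite size_map; case: ifP => _ /=; lia.
Qed.

Definition offset_val (o : Omega) (x : X) : nat := o x.
Local Notation ov := offset_val.

Definition resample (o : Omega) x (k : 'I_K) : Omega :=
  [ffun z => if z == x then k else o z].

(** Resampling one coordinate preserves the uniform measure, because exchanging [o x] with [k] is an
    involution on pairs. *)
Lemma sum_resample (G : Omega -> nat) x :
  (\sum_o \sum_k G (resample o x k) = K * \sum_o G o)%N.
Proof.
rewrite pair_big /=.
pose h (p : Omega * 'I_K) := (resample p.1 x p.2, p.1 x).
have hK : involutive h.
  move=> [o k]; rewrite /h /=; congr (_, _); last by rewrite ffunE eqxx.
  by apply/ffunP => z; rewrite !ffunE; case: eqP => [->|].
rewrite [RHS](_ : _ = \sum_(p : Omega * 'I_K) G p.1)%N.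
  by rewrite [RHS](reindex_inj (inv_inj hK)).
rewrite -(pair_bigA_idem _ (fun o k => G o)) //=.
rewrite big_distrr /=; apply: eq_bigr => o _.
by rewrite sum_nat_const card_ord.
Qed.

(** Such a [k] is determined by its quotient by [m], which takes at most [r] values. *)
Lemma count_residue c m a r :
  (0 < m)%N -> (K = r * m)%N -> (\sum_(k < K) ((c + k) %% m == a) <= r)%N.
Proof.
move=> m0 Kr; rewrite -big_mkcond /= sum1dep_card.
case: r Kr => [|r] Kr.
  by have := modulus_gt0; rewrite Kr.
pose q (k : 'I_K) : 'I_r.+1 := inord (k %/ m).
rewrite -[leqRHS]card_ord -(card_in_imset (f := q)); first exact: max_card.
move=> k k'; rewrite !inE => /eqP ka /eqP k'a /(congr1 val).
have qlt (j : 'I_K) : (j %/ m < r.+1)%N by rewrite ltn_divLR // -Kr.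
rewrite /= !inordK // => qq; apply: val_inj => /=.
rewrite (divn_eq k m) (divn_eq k' m) qq; congr addn.
by apply/eqP; rewrite -(eqn_modDl c) ka k'a.
Qed.

(** Union bound: only elements [z] over the same node can collide with [x], each with probability
    [1 / M v], and [M_deg] bounds the total by [1 / C]. *)
Lemma count_repeat st (o : Omega) x s : uniq s -> x \notin s ->
  (C * \sum_k (shifted_cell st (ov (resample o x k)) x \in
     [seq shifted_cell st (ov (resample o x k)) z | z <- s]) <= K)%N.
Proof.
move=> us xs; pose v := nd x; have [r Kr] := dvdnP (dvdn_modulus v).
apply: (@leq_trans (C * (#|[set x | nd x == v]| * r))); last first.
  by rewrite mulnA Kr mulnC leq_mul2l M_deg orbT.
rewrite leq_mul2l; apply/orP; right.
apply: (@leq_trans (\sum_(z <- s | nd z == v) \sum_(k < K)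
    ((st x + k) %% M v == (st z + o z) %% M v)))%N.
  rewrite exchange_big /=; apply: leq_sum => k _.
  have -> : [seq shifted_cell st (ov (resample o x k)) z | z <- s] = [seq shifted_cell st (ov o) z | z <- s].
    apply/eq_in_map => z zs; rewrite /shifted_cell /ov ffunE.
    by case: eqP => // zx; rewrite -zx zs in xs.
  case: (boolP (_ \in _)) => // /mapP[z zs].
  rewrite /shifted_cell /ov ffunE eqxx => -[vz eqz].
  rewrite big_mkcond (bigD1_seq z) //= -vz eqxx /v eqz.
  by rewrite -[M (nd z)]/(M (nd z)) -vz eqxx.
apply: (@leq_trans (\sum_(z <- s | nd z == v) r)%N).
  by apply: leq_sum => z _; exact: count_residue.
rewrite big_const_seq iter_addn_0 mulnC leq_mul2r; apply/orP; right.
rewrite -size_filter cardE; apply: uniq_leq_size; first exact: filter_uniq.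
by move=> z; rewrite mem_filter mem_enum inE => /andP[].
Qed.

(** Conditioned on the other offsets, a new element repeats a cell with probability at most [1 / C]
    and then costs a factor [C], so it at most doubles the moment. *)
Lemma sum_repeats st s : uniq s ->
  (\sum_(o : Omega) C ^ repeats st (ov o) s <= 2 ^ size s * #|Omega|)%N.
Proof.
elim: s => [_|x s IH /= /andP[xs us]].
  by rewrite /repeats /= mul1n sum_nat_const muln1.
set S := (\sum_(o : Omega) C ^ repeats st (ov o) s)%N in IH *.
pose b (o : Omega) := shifted_cell st (ov o) x \in [seq shifted_cell st (ov o) z | z <- s].
apply: (@leq_trans (S + C * \sum_(o : Omega) C ^ repeats st (ov o) s * b o)%N).
  rewrite /S big_distrr -big_split /=; apply: leq_sum => o _.
  rewrite repeats_cons -/(b o); case: (b o) => /=.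
    by rewrite addn1 expnS muln1 leq_addl.
  by rewrite addn0 leq_addr.
have : (C * \sum_(o : Omega) C ^ repeats st (ov o) s * b o <= S)%N.
  rewrite -(leq_pmul2l modulus_gt0) mulnCA -(sum_resample _ x) /S.
  rewrite !big_distrr /=; apply: leq_sum => o _.
  have repE k : repeats st (ov (resample o x k)) s = repeats st (ov o) s.
    rewrite /repeats; congr (_ - size (undup _))%N.
    apply/eq_in_map => z zs; rewrite /shifted_cell /ov ffunE.
    by case: eqP => // zx; rewrite -zx zs in xs.
  under eq_bigr do rewrite repE.
  rewrite -big_distrr /= mulnCA mulnC leq_mul2r; apply/orP; right.
  exact: count_repeat.
move=> le2; apply: (@leq_trans (2 * S)); first by rewrite mul2n -addnn leq_add2l.
by rewrite expnS -mulnA leq_mul2l IH.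
Qed.

End RandomOffsets.

(** * Offsets that are good for all blocked sets at once *)

Lemma expr1D_lt2 (F : realFieldType) (e : F) (p : nat) :
  0 <= e -> 4 * (p%:R * e) <= 1 -> (1 + e) ^+ p < 2.
Proof.
move=> e0 pe.
have H : (1 + e) ^+ p * (1 - p%:R * e) <= 1.
  elim: p {pe} => [|p IH]; first by rewrite expr0 mul0r subr0 mulr1.
  apply: le_trans IH; rewrite exprS mulrC mulrA [leRHS]mulrC.
  apply: ler_wpM2r; first by rewrite exprn_ge0 // addr_ge0.
  by rewrite -natr1; have : 0 <= (p%:R : F) by []; nra.
have : 0 <= (1 + e) ^+ p by rewrite exprn_ge0 // addr_ge0.
by nra.
Qed.

Section GoodOffsets.
Variables (I V : finType) (d L : nat) (y : I -> 'I_d -> V) (M : V -> nat) (c0 : nat).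
Hypothesis d_eq : d = (2 * L)%N.
Hypothesis L_gt0 : (0 < L)%N.
Hypothesis c0_ge : (128 <= c0)%N.
Hypothesis I_le : (#|I| <= 4 ^ L)%N.
Local Notation X := (I * 'I_d)%type.
Local Notation nd := (fun x : X => y x.1 x.2).
Hypothesis M_gt0 : forall v, (0 < M v)%N.
Hypothesis M_deg : forall v, (c0 ^ 2 * #|[set x : X | y x.1 x.2 == v]| <= M v)%N.

(** The state in which a greedy traveller arrives at position [t] when the positions in [A] are
    blocked. *)
Definition passed (A : {set 'I_d}) (t : 'I_d) : nat :=
  #|[set t' : 'I_d | (t' < t)%N && (t' \notin A)]|.

(** The blocked visits, viewed as balls thrown into the cells. *)
Definition balls (T : {ffun I -> {set 'I_d}}) : seq X :=
  [seq x <- enum [set: X] | x.2 \in T x.1].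

Lemma size_balls T : size (balls T) = (\sum_i #|T i|)%N.
Proof.
rewrite /balls size_filter -sum1_count big_enum_cond /=.
under eq_bigl do rewrite finset.in_setT /=.
rewrite -(pair_big_dep xpredT (fun i t => t \in T i) (fun _ _ => 1%N)) /=.
by apply: eq_bigr => i _; rewrite sum1_card.
Qed.

(** Probabilistic method. If [T] with [b] balls violates the bound, more than half of the balls are
    repeats, so Markov's inequality for [(c0 ^ 2) ^ repeats] gives probability at most
    [(2 / c0) ^ b]. The sum of these weights over all valid nonempty families is below 1. *)
Lemma good_offsets (F : realFieldType) : exists o : X -> nat, forall T : {ffun I -> {set 'I_d}},
  (forall i, T i = finset.set0 \/ (L <= #|T i|)%N) ->
  (size (balls T) <= 2 * size (undup
     [seq shifted_cell nd M (fun x => passed (T x.1) x.2) o x | x <- balls T]))%N.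
Proof.
pose Om := {ffun X -> 'I_(modulus M)}.
pose Tt := {ffun I -> {set 'I_d}}.
pose okset (A : {set 'I_d}) := (A == finset.set0) || (L <= #|A|)%N.
pose valid (T : Tt) := [forall i, okset (T i)].
pose und (o : Om) (T : Tt) := size (undup
     [seq shifted_cell nd M (fun x => passed (T x.1) x.2) (offset_val o) x | x <- balls T]).
case: (pickP (fun o : Om => [forall T : Tt, valid T ==> (size (balls T) <= 2 * und o T)%N])).
  move=> o /forallP ho; exists (offset_val o) => T Tv; apply: (implyP (ho T)).
  by apply/forallP => i; apply/orP; case: (Tv i) => [->|]; [left|right].
move=> none; exfalso.
pose rp (o : Om) (T : Tt) := repeats nd M (fun x => passed (T x.1) x.2) (offset_val o) (balls T).
pose w : F := 2 / c0%:R.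
have c0R : (128 : F) <= c0%:R by rewrite (ler_nat _ 128).
have c0p : 0 < (c0%:R : F) by lra.
have w0 : 0 <= w by rewrite divr_ge0.
have w64 : w <= 64^-1 by rewrite /w ler_pdivrMr //; lra.
(* The family with nothing blocked is never violated. Adding back its weight 1 brings the total to
   at least 2, which the product bound then contradicts. *)
have bad (o : Om) : 1 <= \sum_(T | valid T && (T != [ffun=> finset.set0]))
    ((c0 ^ 2) ^ rp o T)%:R / c0%:R ^+ size (balls T) :> F.
  have /negbT := none o; rewrite negb_forall => /existsP[T].
  rewrite negb_imply -ltnNge => /andP[Tv Tlt].
  have T0 : T != [ffun=> finset.set0].
    apply: contraTneq Tlt => ->; rewrite /und size_balls big1 ?ltn0 //.
    by move=> i _; rewrite ffunE cards0.
  rewrite (bigD1 T) ?Tv ?T0 //=.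
  rewrite -[leLHS]addr0; apply: lerD; last by apply: sumr_ge0 => ? _; rewrite divr_ge0 ?exprn_ge0 ?ler0n.
  rewrite ler_pdivlMr ?exprn_gt0 // mul1r -natrX ler_nat -expnM.
  rewrite leq_exp2l; last by lia.
  rewrite /rp /repeats -/(und o T); move: (und o T) Tlt => u; move: (size _) => b ub; lia.
have sumT (T : Tt) : \sum_(o : Om) ((c0 ^ 2) ^ rp o T)%:R / c0%:R ^+ size (balls T) <=
    #|{: Om}|%:R * \prod_i w ^+ #|T i|.
  rewrite prodrXr -size_balls /w expr_div_n mulrA -mulr_suml.
  rewrite ler_pdivrMr ?exprn_gt0 // divfK ?expf_neq0 ?gt_eqF //.
  rewrite -natr_sum -natrX -natrM ler_nat [leqRHS]mulnC.
  apply: (sum_repeats M_gt0 M_deg).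
  by apply: filter_uniq; exact: enum_uniq.
have tot : #|{: Om}|%:R <= #|{: Om}|%:R * \sum_(T | valid T && (T != [ffun=> finset.set0]))
   \prod_i w ^+ #|T i| :> F.
  apply: (@le_trans _ _ (\sum_(o : Om) 1)); first by rewrite sumr_const.
  apply: le_trans (ler_sum _ (fun o _ => bad o)) _.
  rewrite exchange_big mulr_sumr /=; apply: ler_sum => T _; exact: sumT.
have Om0 : 0 < (#|{: Om}|%:R : F).
  rewrite ltr0n; apply/card_gt0P; exists [ffun=> Ordinal (modulus_gt0 M_gt0)].
  by [].
move: tot; rewrite -{1}[_%:R]mulr1 ler_pM2l // => tot.
have val0 : valid [ffun=> finset.set0].
  by apply/forallP => i; rewrite ffunE /okset eqxx.
have : 2 <= \sum_(T | valid T) \prod_i w ^+ #|T i| :> F.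
  rewrite (bigD1 [ffun=> finset.set0]) //=.
  rewrite [X in X + _]big1; last by move=> i _; rewrite ffunE cards0 expr0.
  by move: tot; lra.
apply/negP; rewrite -ltNge.
(* The blocked sets are chosen independently for each demand, so the sum over families factors. *)
have -> : \sum_(T | valid T) \prod_i w ^+ #|T i| =
   \prod_(i : I) \sum_(A : {set 'I_d}) (if okset A then w ^+ #|A| else 0) :> F.
  rewrite bigA_distr_bigA big_mkcond /=; apply: eq_bigr => T _.
  case: (boolP (valid T)) => [/forallP Tv|].
    by apply: eq_bigr => i _; rewrite Tv.
  rewrite negb_forall => /existsP[i /negPf Ti].
  by rewrite (bigD1 i) //= Ti mul0r.
pose e : F := (16^-1) ^+ L.
apply: (@le_lt_trans _ _ (\prod_(i : I) (1 + e))); last first.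
  rewrite prodr_const; apply: expr1D_lt2; first by rewrite exprn_ge0 ?invr_ge0 ?ler0n.
  have : (#|I|%:R : F) * e <= 4^-1 ^+ L.
    apply: (@le_trans _ _ (4 ^+ L * e)).
      by apply: ler_wpM2r; [rewrite exprn_ge0 ?invr_ge0 ?ler0n|rewrite -natrX ler_nat].
    by rewrite /e -exprMn; apply: lerXn2r; rewrite ?nnegrE //; lra.
  have : (4^-1 : F) ^+ L <= 4^-1.
    by rewrite -[leRHS]expr1 ler_wiXn2l //; lra.
  by lra.
apply: ler_prod => i _; apply/andP; split.
  by apply: sumr_ge0 => A _; case: ifP => // _; rewrite exprn_ge0 ?invr_ge0 ?ler0n.
(* A nonempty admissible set has at least [L] elements, hence weight at most [64 ^ -L]; there are
   [4 ^ L] subsets, which leaves [e = 16 ^ -L]. *)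
apply: (@le_trans _ _ (\sum_(A : {set 'I_d}) ((A == finset.set0)%:R + (64^-1) ^+ L))).
  apply: ler_sum => A _; rewrite /okset; case: eqP => [->|_] /=.
    by rewrite cards0 expr0 lerDl exprn_ge0 ?invr_ge0 ?ler0n.
  rewrite add0r; case: ifP => [LA|_]; last by rewrite exprn_ge0 ?invr_ge0 ?ler0n.
  apply: (@le_trans _ _ (w ^+ L)); first by apply: ler_wiXn2l => //; lra.
  by apply: lerXn2r; rewrite ?nnegrE //; lra.
rewrite big_split /= (bigD1 finset.set0) //= eqxx big1 => [|A /negPf ->//].
rewrite addr0 lerD2l sumr_const.
have -> : #|{: {set 'I_d}}| = (4 ^ L)%N.
  by rewrite -cardsT -powersetT card_powerset cardsT card_ord d_eq expnM.
rewrite -[leLHS]mulr_natr natrX -exprMn /e; apply: lerXn2r; rewrite ?nnegrE; last by lra.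
  by rewrite mulr_ge0 ?invr_ge0 ?ler0n.
by rewrite invr_ge0 ler0n.
Qed.

End GoodOffsets.

(** * The gap graph: small concurrent flow, expensive cuts *)

Section GapGraph.
Variables (R : realType) (I V : finType) (d L : nat) (y : I -> 'I_d -> V) (c0 N : nat).
Hypothesis d_eq : d = (2 * L)%N.
Hypothesis L_gt0 : (0 < L)%N.
Hypothesis I_gt0 : (0 < #|I|)%N.
Hypothesis y_inj : forall i, injective (y i).

Definition on_path i v := [exists t, y i t == v].
Definition path_step : rel V := fun v v' =>
  [exists j, exists t : 'I_d, exists t' : 'I_d, [&& (t < t')%N, y j t == v & y j t' == v']].

Hypothesis label_unique : forall i j (t t' : 'I_d),
  (t < t')%N -> on_path i (y j t) -> on_path i (y j t') -> j = i.
Hypothesis no_return : forall i u v v',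
  on_path i u -> connect path_step u v -> path_step v v' -> on_path i v' -> on_path i v.

Local Notation nd := (fun x : I * 'I_d => y x.1 x.2).
(** The term proportional to the degree keeps collisions rare; the summand [L] gives one visit
    distinct copies for its [L] states. *)
Definition copies v : nat := (c0 ^ 2 * #|[set x : I * 'I_d | y x.1 x.2 == v]| + L)%N.

Lemma copies_gt0 v : (0 < copies v)%N.
Proof. by rewrite /copies addn_gt0 L_gt0 orbT. Qed.

Variable o : I * 'I_d -> nat.
Hypothesis o_good : forall T : {ffun I -> {set 'I_d}},
  (forall i, T i = finset.set0 \/ (L <= #|T i|)%N) ->
  (size (balls T) <= 2 * size (undup
     [seq shifted_cell nd copies (fun x => passed (T x.1) x.2) o x | x <- balls T]))%N.

Definition cell := {v : V & 'I_(copies v)}.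
Definition cell_at i t c : cell :=
  Tagged (fun v => 'I_(copies v)) (Ordinal (ltn_pmod (c + o (i, t)) (copies_gt0 (y i t)))).
Definition cell_pair (x : cell) : V * nat := (tag x, nat_of_ord (tagged x)).

Lemma cell_at_inj i t t' c c' : (c < L)%N -> (c' < L)%N ->
  cell_at i t c = cell_at i t' c' -> t = t' /\ c = c'.
Proof.
move=> cL c'L E; have := congr1 cell_pair E; case => /y_inj tt.
rewrite {}tt {E} => /eqP; rewrite eqn_modDr => /eqP.
have lt k : (k < L)%N -> (k < copies (y i t'))%N.
  by move=> kL; apply: leq_trans kL _; rewrite /copies leq_addl.
by rewrite !modn_small ?lt.
Qed.

Definition gnode := ((I + I) + (cell * bool))%type.
Definition nS i : gnode := inl (inl i).
Definition nT i : gnode := inl (inr i).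
Definition nIn x : gnode := inr (x, false).
Definition nOut x : gnode := inr (x, true).

(** Edges between copies carry no demand: a route for one demand may follow other paths, and
    [potential] has to account for such detours. *)
Definition gedge (a b : gnode) : bool :=
  match a, b with
  | inl (inl i), inr (x, false) => [exists t, x == cell_at i t 0]
  | inr (x, false), inr (x', true) => x == x'
  | inr (x, true), inr (x', false) =>
      [exists i, exists t : 'I_d, exists t' : 'I_d, exists c : 'I_L,
        [&& (t < t')%N, (c.+1 < L)%N, x == cell_at i t c & x' == cell_at i t' c.+1]]
  | inr (x, true), inl (inr i) => [exists t, x == cell_at i t L.-1]
  | _, _ => false
  end.

Definition special (a b : gnode) : bool :=
  if (a, b) is (inr (x, false), inr (x', true)) then x == x' else false.

(* A lower bound, up to truncation at [L], on the number of copies used on the way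
   from [nS i]: off path [i] it is [0] downstream of the path, since from there the
   path cannot be reached again, and [L] elsewhere. *)
Definition potential i (z : gnode) : nat :=
  match z with
  | inl (inl j) => if j == i then 0%N else L
  | inl (inr j) => if j == i then L else 0%N
  | inr (x, b) =>
      if [pick tc : 'I_d * 'I_L | cell_at i tc.1 tc.2 == x] is Some tc then (tc.2 + b)%N
      else if ~~ on_path i (tag x) && [exists u, on_path i u && connect path_step u (tag x)]
           then 0%N else L
  end.

Lemma potential_le i z : (potential i z <= L)%N.
Proof.
case: z => [[j|j]|[x b]] /=; try by case: ifP.
case: pickP => [[t c] _|_] /=; last by case: ifP.
by have := ltn_ord c; case: b; rewrite ?addn1 ?addn0 //= => /ltnW.
Qed.

Lemma potential_cell_at i t c b : (c < L)%N ->
  potential i (inr (cell_at i t c, b)) = (c + b)%N.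
Proof.
move=> cL /=; case: pickP => [[t' c'] /= /eqP E|/(_ (t, Ordinal cL))]; last by rewrite eqxx.
by have [_ ->] := cell_at_inj (ltn_ord c') cL E.
Qed.

Lemma potential_off i x b : ~~ on_path i (tag x) ->
  potential i (inr (x, b)) =
  if [exists u, on_path i u && connect path_step u (tag x)] then 0%N else L.
Proof.
move=> nx; rewrite /potential; case: pickP => [[t c] /= /eqP E|_]; last by rewrite nx.
by case/negP: nx; apply/existsP; exists t; rewrite -E.
Qed.

(** An edge between copies with both ends on path [i] belongs to path [i] by [label_unique], so the
    state rises by one just as the exit bonus is lost. Leaving the path drops the potential to 0,
    and [no_return] excludes re-entry from downstream. *)
Lemma potential_edge i a b : gedge a b -> (potential i b <= potential i a + special a b)%N.
Proof.
case: a => [[j|j]|[x [|]]]; case: b => [[k|k]|[x' [|]]] //.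
- move=> /existsP[t /eqP ->]; rewrite /special addn0.
  have [->|ji] := eqVneq j i; first by rewrite potential_cell_at.
  by rewrite {2}/potential (negPf ji) potential_le.
- move=> /existsP[t /eqP ->]; rewrite /special addn0.
  have [->|ki] := eqVneq k i; last by rewrite /= (negPf ki).
  by rewrite potential_cell_at /= ?eqxx ?prednK // addn1 prednK.
- move=> /existsP[j /existsP[t /existsP[t' /existsP[c /and4P[tt cL /eqP -> /eqP ->]]]]].
  rewrite addn0.
  have st : path_step (y j t) (y j t').
    apply/existsP; exists j; apply/existsP; exists t.
    by apply/existsP; exists t'; rewrite tt !eqxx.
  have [onv|nonv] := boolP (on_path i (y j t)).
    have [onv'|nonv'] := boolP (on_path i (y j t')).
      have -> := label_unique tt onv onv'.
      by rewrite !potential_cell_at // addn1 addn0.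
    rewrite potential_off //= ifT //; apply/existsP; exists (y j t).
    by rewrite onv connect1.
  rewrite [X in (_ <= X)%N]potential_off //.
  case: ifP => [/existsP[u /andP[onu uv]]|_]; last exact: potential_le.
  have nonv' : ~~ on_path i (y j t').
    by apply: contra nonv => onv'; exact: no_return onu uv st onv'.
  rewrite potential_off //= ifT //; apply/existsP; exists u.
  by rewrite onu; apply: connect_trans uv (connect1 st).
- rewrite /gedge /special => /eqP ->; rewrite eqxx /=.
  by case: pickP => [[t c] _|_] /=; rewrite ?addn1 ?addn0 //; case: ifP => // _; rewrite leqnSn.
Qed.

Variable emb : gnode -> 'I_N.
Hypothesis emb_inj : injective emb.

(** A partial inverse, since [emb] need not be onto; further nodes of ['I_N] stay isolated. *)
Definition dec (n : 'I_N) : option gnode := [pick z | emb z == n].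

Lemma embK : pcancel emb dec.
Proof.
move=> z; rewrite /dec; case: pickP => [z' /eqP/emb_inj ->//|/(_ z)].
by rewrite eqxx.
Qed.

Definition gE : {set 'I_N * 'I_N} :=
  [set (emb p.1, emb p.2) | p in [set p : gnode * gnode | gedge p.1 p.2]].
Definition gP : {set 'I_N * 'I_N} := [set (emb (nS i), emb (nT i)) | i in I].
Definition gW : {set 'I_N * 'I_N} := [set (emb (nIn x), emb (nOut x)) | x : cell].

Lemma gEP a b : ((emb a, emb b) \in gE) = gedge a b.
Proof.
apply/imsetP/idP => [[[a' b']]|ab]; last by exists (a, b); rewrite ?inE.
by rewrite inE /= => ab [] /emb_inj -> /emb_inj ->.
Qed.

Lemma gWP a b : ((emb a, emb b) \in gW) = special a b.
Proof.
apply/imsetP/idP => [[x _ [] /emb_inj -> /emb_inj ->]|]; first exact: eqxx.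
case: a => [[j|j]|[x [|]]]; case: b => [[k|k]|[x' [|]]] //= /eqP ->.
by exists x'.
Qed.

Lemma card_gP : #|gP| = #|I|.
Proof. by rewrite card_imset // => i j [] /emb_inj [] ->. Qed.

Lemma gP_neq p : p \in gP -> p.1 != p.2.
Proof. by case/imsetP => i _ ->; rewrite /= (inj_eq emb_inj). Qed.

Lemma gP_neq0 : gP != finset.set0.
Proof. by rewrite -card_gt0 card_gP. Qed.

Lemma card_cell : #|{: cell}| = (c0 ^ 2 * (d * #|I|) + #|V| * L)%N.
Proof.
rewrite card_tagged sumnE big_map big_enum /=.
under eq_bigr do rewrite card_ord.
rewrite big_split /= sum_nat_const -big_distrr /=; congr (_ * _ + _)%N.
rewrite mulnC -[d in RHS]card_ord -card_prod -sum1_card.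
rewrite (partition_big (fun x : I * 'I_d => y x.1 x.2) xpredT) //=.
by apply: eq_bigr => v _; rewrite sum1dep_card.
Qed.

Lemma gap_flow : MCFlow R gE gP * (L%:R * #|I|%:R) <= #|{: cell}|%:R.
Proof.
pose phi (p : 'I_N * 'I_N) (n : 'I_N) : R :=
  if [pick i | p == (emb (nS i), emb (nT i))] is Some i then
    (if dec n is Some z then (potential i z)%:R else 0) else 0.
have phiE i z : phi (emb (nS i), emb (nT i)) (emb z) = (potential i z)%:R.
  rewrite /phi; case: pickP => [j /eqP [] /emb_inj [] -> _|/(_ i)]; last by rewrite eqxx.
  by rewrite embK.
have WE : gW \subset gE.
  apply/fintype.subsetP => e /imsetP[x _ ->]; rewrite gEP /=; exact: eqxx.
have := @MCFlow_le R N gE gP gW phi L%:R gP_neq0 gP_neq WE.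
rewrite card_gP ltr0n => /(_ L_gt0) H.
apply: le_trans (H _ _) _.
- by move=> p /imsetP[i _ ->]; rewrite !phiE /= eqxx.
- move=> p e /imsetP[i _ ->] /imsetP[[a b]]; rewrite inE /= => ab ->.
  by rewrite !phiE gWP -natrD ler_nat potential_edge.
by rewrite ler_nat leq_imset_card.
Qed.

Section Cut.
Variable E' : {set 'I_N * 'I_N}.

(** Charges a cut edge to a single copy, its head if that is a copy and otherwise its tail, so that
    [E'] spoils at most [#|E'|] copies. *)
Definition edge_cell (e : 'I_N * 'I_N) : option cell :=
  match dec e.1, dec e.2 with
  | _, Some (inr (x, _)) => Some x
  | Some (inr (x, _)), _ => Some x
  | _, _ => None
  end.
Definition cut_cells : {set cell} := [set x | Some x \in [set edge_cell e | e in E']].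

Lemma card_cut_cells : (#|cut_cells| <= #|E'|)%N.
Proof.
have si : injective (@Some cell) by move=> ? ? [].
rewrite -(card_imset _ si); apply: leq_trans (leq_imset_card edge_cell E').
apply: subset_leq_card; apply/fintype.subsetP => z /imsetP[x xX ->].
by move: xX; rewrite inE.
Qed.

Lemma uncut_edge x a b : x \notin cut_cells -> gedge a b ->
  edge_cell (emb a, emb b) = Some x -> (emb a, emb b) \in gE :\: E'.
Proof.
move=> xX ab ex; rewrite finset.in_setD gEP ab andbT; apply: contra xX => abE.
by rewrite inE; apply/imsetP; exists (emb a, emb b).
Qed.

Local Notation con := (connect (fun u v => (u, v) \in gE :\: E')).

(* The state of demand [i] after the first [n] nodes of its path, when it advances
   at every node whose copy for the current state survives the cut. *)
Fixpoint cnt i (n : nat) : nat :=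
  if n is m.+1 then
    (cnt i m + (if insub m is Some t then cell_at i t (cnt i m) \notin cut_cells else false))%N
  else 0%N.

Definition blocked i : {set 'I_d} := [set t : 'I_d | cell_at i t (cnt i t) \in cut_cells].

Lemma cntS i (t : 'I_d) : cnt i t.+1 = (cnt i t + (t \notin blocked i))%N.
Proof.
have -> : (t \notin blocked i) = (cell_at i t (cnt i t) \notin cut_cells) by rewrite inE.
by rewrite [cnt i t.+1]/cnt -/(cnt i t) valK.
Qed.

(** Brings the recursive state into the form of [passed], in which it enters [o_good]. *)
Lemma cntE i n : (n <= d)%N ->
  cnt i n = #|[set t : 'I_d | (t < n)%N && (t \notin blocked i)]|.
Proof.
elim: n => [_|n IH ltnd]; first by rewrite eq_card0 // => t; rewrite inE.
pose t0 := Ordinal ltnd.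
have -> : cnt i n.+1 = (cnt i n + (t0 \notin blocked i))%N := cntS i t0.
rewrite (IH (ltnW ltnd)) {IH}.
rewrite [in RHS](cardsD1 t0) addnC; congr (_ + _)%N.
  by rewrite inE ltnSn.
apply: eq_card => t; rewrite !inE -(inj_eq val_inj) /= ltnS.
by case: (ltngtP t n).
Qed.

(** At the position where the state moves from [c] to [c.+1] the copy is uncut. State [c.-1] was
    completed earlier on the path, and an edge of path [i], charged to the uncut copy, leads from
    there to here. *)
Lemma greedy_route i n c : (n <= d)%N -> (c < cnt i n)%N -> (c < L)%N ->
  exists2 t : 'I_d, (t < n)%N & (cell_at i t c \notin cut_cells) &&
     con (emb (nS i)) (emb (nOut (cell_at i t c))).
Proof.
elim: n c => // n IH c ltnd; pose t0 := Ordinal ltnd.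
have -> : cnt i n.+1 = (cnt i n + (t0 \notin blocked i))%N := cntS i t0.
rewrite [_ \in blocked i]inE => clt cL.
have [clt'|cge] := ltnP c (cnt i n).
  by have [t tn H] := IH c (ltnW ltnd) clt' cL; exists t => //; apply: ltnW.
move: clt; case: (boolP (_ \notin _)) => [xX|_]; last by rewrite addn0 ltnNge cge.
rewrite addn1 ltnS => cle; have cE : cnt i n = c by apply/eqP; rewrite eqn_leq cge cle.
rewrite {}cE in xX cge cle IH *.
exists t0 => //; rewrite xX /=.
have inout : con (emb (nIn (cell_at i t0 c))) (emb (nOut (cell_at i t0 c))).
  apply: connect1; apply: uncut_edge xX _ _; first by rewrite /= eqxx.
  by rewrite /edge_cell !embK.
apply: connect_trans inout.
case: c xX cge cle IH cL => [|c] xX cge cle IH cL.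
  apply: connect1; apply: uncut_edge xX _ _; last by rewrite /edge_cell !embK.
  by apply/existsP; exists t0.
have [t tn /andP[_ H]] := IH c (ltnW ltnd) (ltnSn c) (ltnW cL).
apply: connect_trans H _; apply: connect1; apply: uncut_edge xX _ _; last by rewrite /edge_cell !embK.
apply/existsP; exists i; apply/existsP; exists t; apply/existsP; exists t0.
by apply/existsP; exists (Ordinal (ltnW cL)); rewrite tn cL !eqxx.
Qed.

(** With fewer than [L] of the [2 * L] positions blocked, the greedy route completes state [L.-1]
    and may exit to the sink. *)
Lemma blocked_large i : ~~ con (emb (nS i)) (emb (nT i)) -> (L <= #|blocked i|)%N.
Proof.
move=> ncon; rewrite leqNgt; apply: contra ncon => bL.
have : (L.-1 < cnt i d)%N.
  rewrite cntE // prednK //.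
  have -> : [set t : 'I_d | (t < d)%N && (t \notin blocked i)] = ~: blocked i.
    by apply/setP => t; rewrite !inE ltn_ord.
  rewrite -(leq_add2l #|blocked i|) cardsC card_ord.
  by move: bL; move: #|blocked i| => b bL; move: d_eq; lia.
move=> Lc; have LL : (L.-1 < L)%N by rewrite prednK.
have [t _ /andP[xX H]] := greedy_route (leqnn d) Lc LL.
apply: connect_trans H _; apply: connect1; apply: uncut_edge xX _ _.
  by apply/existsP; exists t.
by rewrite /edge_cell !embK.
Qed.

(** Take the blocked sets of the disconnected demands: at least [L] balls for each, occupying at
    least half as many distinct cells by [o_good], and all these cells are cut. *)
Lemma gap_cut : (L * #|cut_pairs gE gP E'| <= 2 * #|E'|)%N.
Proof.
pose J := [set i | ~~ con (emb (nS i)) (emb (nT i))].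
pose T : {ffun I -> {set 'I_d}} := [ffun i => if i \in J then blocked i else finset.set0].
have TV i : T i = finset.set0 \/ (L <= #|T i|)%N.
  rewrite ffunE; case: ifP => [|_]; last by left.
  by rewrite inE => /blocked_large; right.
have cJ : (#|cut_pairs gE gP E'| <= #|J|)%N.
  apply: leq_trans (leq_imset_card (fun i => (emb (nS i), emb (nT i))) J).
  apply: subset_leq_card; apply/fintype.subsetP => p; rewrite inE => /andP[/imsetP[i _ ->] nc].
  by apply: imset_f; rewrite inE.
apply: (@leq_trans (L * #|J|)); first by rewrite leq_mul2l cJ orbT.
apply: (@leq_trans (size (balls T))).
  rewrite size_balls mulnC -sum_nat_const big_mkcond /=; apply: leq_sum => i _.
  case: ifP => // iJ; have [|//] := TV i; rewrite ffunE iJ => b0.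
  by move: iJ; rewrite inE => /blocked_large; rewrite b0 cards0 leqn0 => /eqP ->.
apply: leq_trans (o_good TV) _; rewrite leq_mul2l /=.
apply: leq_trans card_cut_cells.
rewrite cardE -(size_map cell_pair); apply: uniq_leq_size; first exact: undup_uniq.
move=> q; rewrite mem_undup => /mapP[[i t]]; rewrite mem_filter => /andP[/= tT _] ->.
apply/mapP; exists (cell_at i t (passed (T i) t)) => //; rewrite mem_enum.
have [iJ|niJ] := boolP (i \in J); last by rewrite ffunE (negPf niJ) inE in tT.
have TE : T i = blocked i by rewrite ffunE iJ.
rewrite {}TE in tT *; rewrite /passed -(cntE _ (ltnW (ltn_ord t))).
by move: tT; rewrite inE.
Qed.

End Cut.

(** The cut ratio is at least [L / 2], while the flow is at most the number of copies divided by
    [L * #|I|], that is at most [2 * c0 ^ 2 + 4]. *)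
Lemma gap_bound k : SCG_bound R N k -> (#|V| <= 4 * #|I|)%N ->
  (L <= (4 * c0 ^ 2 + 8) * k)%N.
Proof.
move=> /(_ gE gP gP_neq0 gP_neq) kb VI.
have cutL : (L%:R / 2 : R) <= SCut R gE gP.
  apply: SCut_ge gP_neq0 gP_neq _ => E' _.
  rewrite -mulrAC ler_pdivrMr // -!natrM ler_nat [leqRHS]mulnC; exact: gap_cut.
have L0 : 0 < (L%:R : R) by rewrite ltr0n.
have I0 : 0 < (#|I|%:R : R) by rewrite ltr0n.
have cellE : (#|{: cell}| <= (2 * c0 ^ 2 + 4) * (L * #|I|))%N.
  rewrite card_cell d_eq; move: (c0 ^ 2)%N => c; nia.
have : L%:R / 2 * (L%:R * #|I|%:R) <= k%:R * (((2 * c0 ^ 2 + 4) * (L * #|I|))%N%:R : R).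
  apply: (@le_trans _ _ (k%:R * (MCFlow R gE gP * (L%:R * #|I|%:R)))).
    by rewrite [leRHS]mulrA ler_pM2r ?mulr_gt0 // (le_trans cutL).
  apply: ler_wpM2l; first exact: ler0n.
  by apply: le_trans gap_flow _; rewrite ler_nat.
rewrite mulrAC ler_pdivrMr // -!natrM ler_nat.
have LI : (0 < L * #|I|)%N by rewrite muln_gt0 L_gt0.
move=> H; rewrite -(leq_pmul2r LI); apply: leq_trans H _.
by move: (c0 ^ 2)%N (L * #|I|)%N => c m; nia.
Qed.

End GapGraph.

(* Locked to keep the numeral from being computed in unary. *)
Definition gap_const : nat := locked (8 * 128 ^ 2 + 20)%N.

(** The construction with [c0 = 128], the threshold of [good_offsets]; [gap_const] is large enough
    for both the node count and the loss in the ratio. *)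
Lemma gap_theorem (R : realType) (I V : finType) (d L N k : nat) (y : I -> 'I_d -> V) :
  d = (2 * L)%N -> (0 < L)%N -> (0 < #|I|)%N -> (#|I| <= 4 ^ L)%N -> (#|V| <= 4 * #|I|)%N ->
  (forall i, injective (y i)) ->
  (forall i j (t t' : 'I_d), (t < t')%N ->
     on_path y i (y j t) -> on_path y i (y j t') -> j = i) ->
  (forall i u v v', on_path y i u -> connect (path_step y) u v -> path_step y v v' ->
     on_path y i v' -> on_path y i v) ->
  (gap_const * (#|I| * L) <= N)%N -> SCG_bound R N k -> (L <= gap_const * k)%N.
Proof.
move=> dE L0 I0 IL VI yi lu nr NI kb.
have Md v : (128 ^ 2 * #|[set x : I * 'I_d | y x.1 x.2 == v]| <= copies L y 128 v)%N.
  by rewrite /copies leq_addr.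
have [o og] := good_offsets dE L0 (leqnn 128) IL (copies_gt0 y 128 L0) Md R.
have Nge : (#|{: gnode L y 128}| <= N)%N.
  apply: leq_trans NI; rewrite !card_sum card_prod card_bool card_cell dE /gap_const -lock.
  move: (128 ^ 2)%N => c; nia.
pose emb (z : gnode L y 128) : 'I_N := widen_ord Nge (enum_rank z).
have emb_inj : injective emb.
  by move=> a b /(congr1 val) /= /val_inj /enum_rank_inj.
have := gap_bound dE L0 I0 yi lu nr og emb_inj kb VI.
rewrite /gap_const -lock; move: (128 ^ 2)%N => c; nia.
Qed.

(** * Lines with directions on a parabola *)

Section ParabolaLines.
Variable d : nat.
Definition line := ('I_d * 'I_(d ^ 2) * 'I_(d ^ 3))%type.
Definition point := ('I_d * 'I_(2 * d ^ 2) * 'I_(2 * d ^ 3))%type.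

Lemma line_coord1 (i : line) (t : 'I_d) : (i.1.2 + t * i.1.1 < 2 * d ^ 2)%N.
Proof.
case: i => [[a b] c] /=; have := ltn_ord a; have := ltn_ord b; have := ltn_ord t.
move: (nat_of_ord a) (nat_of_ord b) (nat_of_ord t) => {}a {}b {}t.
rewrite -!mulnn; nia.
Qed.

Lemma line_coord2 (i : line) (t : 'I_d) : (i.2 + t * i.1.1 ^ 2 < 2 * d ^ 3)%N.
Proof.
case: i => [[a b] c] /=.
have : (t * a ^ 2 <= d ^ 3)%N.
  by rewrite [(d ^ 3)%N]expnS leq_mul // ?leq_exp2r // ltnW.
have := ltn_ord c; lia.
Qed.

Definition line_point (i : line) (t : 'I_d) : point :=
  (t, Ordinal (line_coord1 i t), Ordinal (line_coord2 i t)).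

Lemma line_point_inj i : injective (line_point i).
Proof. by move=> t t' []. Qed.

(* [tilt i] is constant on the line [i], and a step of length [s] along a line of
   slope [a] raises it by [s * (a - slope i) ^ 2]. *)
Definition tilt (i : line) (v : point) : int :=
  (v.2 : nat)%:Z + ((i.1.1 : nat)%:Z) ^+ 2 * (v.1.1 : nat)%:Z - 2 * (i.1.1 : nat)%:Z * (v.1.2 : nat)%:Z.

Lemma tilt_point (i j : line) (t : 'I_d) :
  tilt i (line_point j t) = (j.2 : nat)%:Z - 2 * (i.1.1 : nat)%:Z * (j.1.2 : nat)%:Z
    + (t : nat)%:Z * ((j.1.1 : nat)%:Z - (i.1.1 : nat)%:Z) ^+ 2.
Proof.
rewrite /tilt /=; move: (nat_of_ord j.1.1) (nat_of_ord j.1.2) (nat_of_ord j.2) => a b c.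
by rewrite -mulnn !PoszD !PoszM; ring.
Qed.

Lemma tilt_on i v : on_path line_point i v ->
  tilt i v = (i.2 : nat)%:Z - 2 * (i.1.1 : nat)%:Z * (i.1.2 : nat)%:Z.
Proof. by case/existsP => t /eqP <-; rewrite tilt_point subrr expr0n mulr0 addr0. Qed.

Lemma tilt_step i v v' : path_step line_point v v' -> tilt i v <= tilt i v'.
Proof.
case/existsP => j /existsP[t /existsP[t' /and3P[tt /eqP <- /eqP <-]]].
rewrite !tilt_point lerD2l; apply: ler_wpM2r; first exact: sqr_ge0.
by rewrite lez_nat ltnW.
Qed.

Lemma tilt_connect i u v : connect (path_step line_point) u v -> tilt i u <= tilt i v.
Proof.
case/connectP => w; elim: w u => [|z w IH] u /=; first by move=> _ ->.
by case/andP => /(tilt_step i) uz pw lw; apply: le_trans uz (IH z pw lw).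
Qed.

(** Equal tilt at two points of [j] forces equal slopes, and parallel lines with a common point
    coincide. *)
Lemma line_unique i j (t t' : 'I_d) : (t < t')%N ->
  tilt i (line_point j t) = tilt i (line_point j t') ->
  on_path line_point i (line_point j t') -> j = i.
Proof.
move=> tt; rewrite !tilt_point => /addrI eqt on'.
have aa : j.1.1 = i.1.1 :> nat.
  have : ((t' : nat)%:Z - (t : nat)%:Z) * ((j.1.1 : nat)%:Z - (i.1.1 : nat)%:Z) ^+ 2 = 0.
    by rewrite mulrBl eqt subrr.
  move/eqP; rewrite mulf_eq0 expf_eq0 /= => /orP[|]; first by rewrite subr_eq0 => /eqP; lia.
  by rewrite subr_eq0 => /eqP; lia.
case/existsP: on' => s /eqP E; have := E.
case=> st E1 E2; have {}st : s = t' :> nat by rewrite st.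
move: E1 E2; rewrite st aa => /addIn E1 /addIn E2.
case: j i E1 E2 aa {eqt E st} => [[a b] c] [[a' b'] c'] /= E1 E2 aa.
by congr (_, _, _); apply: val_inj.
Qed.

Lemma line_label_unique i j (t t' : 'I_d) : (t < t')%N ->
  on_path line_point i (line_point j t) -> on_path line_point i (line_point j t') -> j = i.
Proof. by move=> tt o1 o2; apply: (line_unique tt _ o2); rewrite (tilt_on o1) (tilt_on o2). Qed.

(** The tilt never decreases along steps and has the same value at both visits to line [i], so the
    last step does not raise it and must run along [i]. *)
Lemma line_no_return i u v v' : on_path line_point i u ->
  connect (path_step line_point) u v -> path_step line_point v v' ->
  on_path line_point i v' -> on_path line_point i v.
Proof.
move=> onu uv st onv'.
have E : tilt i v = tilt i v'.
  apply/eqP; rewrite eq_le tilt_step //= (tilt_on onv') -(tilt_on onu).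
  exact: tilt_connect.
case/existsP: st => j /existsP[t /existsP[t' /and3P[tt /eqP vE /eqP v'E]]].
rewrite -vE -v'E in E onv' *; rewrite (line_unique tt E onv').
by apply/existsP; exists t.
Qed.

End ParabolaLines.

(** The fallback for small [beta_inf]: a gap of order [L] from a node count of order [L ^ 7]. *)
Lemma gap_of_lines (R : realType) (L N k : nat) :
  (0 < L)%N -> ((2 * L) ^ 6 <= 4 ^ L)%N -> (gap_const * ((2 * L) ^ 6 * L) <= N)%N ->
  SCG_bound R N k -> (L <= gap_const * k)%N.
Proof.
move=> L0 L6 LN; set d := (2 * L)%N.
have d0 : (0 < d)%N by rewrite /d muln_gt0.
have cI : #|{: line d}| = (d ^ 6)%N.
  by rewrite !card_prod !card_ord -expnS -expnD.
have cV : #|{: point d}| = (4 * d ^ 6)%N.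
  by rewrite !card_prod !card_ord (expnD d 3 3) !expnS expn0; ring.
apply: (@gap_theorem R (line d) (point d) d L N k (@line_point d)) => //.
- by rewrite cI expn_gt0 d0.
- by rewrite cI.
- by rewrite cI cV.
- exact: line_point_inj.
- exact: line_label_unique.
- exact: line_no_return.
- by rewrite cI.
Qed.

(** * Rainbow walks, cycle contraction and protected paths *)

Lemma uniq_map_split (T S : eqType) (F : T -> S) (c : seq T) :
  (forall p x s y r, c = p ++ x :: s ++ y :: r -> F x <> F y) -> uniq (map F c).
Proof.
elim: c => //= x c IH H; apply/andP; split.
  apply/negP => /mapP[y yc Fxy]; move: H; case/splitPr: yc => s r H.
  exact: (H [::] x s y r).
by apply: IH => p x' s y r cE; apply: (H (x :: p) x' s y r); rewrite cE.
Qed.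

Section Rainbow.
Variables (V I : finType) (on : I -> pred V) (pos : I -> V -> nat).
Hypothesis pos_inj : forall j u v, on j u -> on j v -> pos j u = pos j v -> u = v.

Definition before j u v := [&& on j u, on j v & (pos j u < pos j v)%N].

Fixpoint lwalk u (s : seq (I * V)) : bool :=
  if s is x :: s' then before x.1 u x.2 && lwalk x.2 s' else true.
Definition lend u (s : seq (I * V)) := last u (unzip2 s).
Definition rainbow u s := [&& lwalk u s, uniq (unzip1 s) & uniq (u :: unzip2 s)].

Hypothesis no_bridge : forall u s j,
  rainbow u s -> j \notin unzip1 s -> ~~ before j u (lend u s).

Lemma lwalk_cat u s r : lwalk u (s ++ r) = lwalk u s && lwalk (lend u s) r.
Proof. by elim: s u => //= x s IH u; rewrite IH andbA. Qed.

Lemma lend_cat u s r : lend u (s ++ r) = lend (lend u s) r.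
Proof. by rewrite /lend /unzip2 map_cat last_cat. Qed.

Lemma rainbow_cat u s j v r :
  rainbow u s -> before j (lend u s) v -> rainbow v r ->
  (forall i, i \in unzip1 s -> i \notin j :: unzip1 r) -> j \notin unzip1 r ->
  (forall z, z \in u :: unzip2 s -> z \notin v :: unzip2 r) ->
  rainbow u (s ++ (j, v) :: r).
Proof.
move=> /and3P[w1 l1 n1] jv /and3P[w2 l2 n2] ld jr ndj.
rewrite /rainbow lwalk_cat w1 /= jv w2 /= /unzip1 /unzip2 !map_cat /=.
rewrite -/(unzip1 s) -/(unzip1 r) -/(unzip2 s) -/(unzip2 r).
apply/andP; split.
  rewrite cat_uniq; apply/and3P; split=> //; last by rewrite /= jr.
  by apply/hasPn => i ir; apply/negP => /ld; rewrite ir.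
rewrite -[_ && _]/(uniq ((u :: unzip2 s) ++ v :: unzip2 r)) cat_uniq n1 n2 andbT.
by apply/hasPn => z zr; apply/negP => /ndj; rewrite zr.
Qed.

Section Merge.
(* [f] sends a node to its block; [g j = Some b] when the label [j] has been spent
   inside block [b]. *)
Variables (f : V -> V) (g : I -> option V).
(** The invariant of the contraction. Confining each walk to its block and to labels spent there
    lets walks of different blocks be concatenated. *)
Definition linked := forall u w, f u = f w -> exists s,
  [/\ rainbow u s, lend u s = w, all (fun z => f z == f u) (unzip2 s) &
      all (fun j => g j == Some (f u)) (unzip1 s)].
Hypothesis fg : linked.

Local Notation arrow := (V * I * V)%type.
Definition src (x : arrow) := x.1.1.
Definition lab (x : arrow) := x.1.2.
Definition tgt (x : arrow) := x.2.
Definition fresh (x : arrow) := (g (lab x) == None) && before (lab x) (src x) (tgt x).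
(** Consecutive arrows need only meet in a block, so a [block_cycle] is a cycle of the contracted
    graph. *)
Definition follows : rel arrow := fun x y => f (tgt x) == f (src y).
Definition block_cycle c := [&& c != [::], all fresh c & cycle follows c].

Lemma path_follows_tgt x z s : tgt x = tgt z -> path follows x s = path follows z s.
Proof. by case: s => //= y s; rewrite /follows => ->. Qed.

Lemma tgt_last x z s : tgt x = tgt z -> tgt (last x s) = tgt (last z s).
Proof. by case: s. Qed.

(** Inside each block, join entry to exit by the walk from [fg]. Distinct blocks make these walks
    disjoint in nodes and in spent labels, and the arrows between them carry distinct fresh
    labels. *)
Lemma chain_rainbow s x y u w :
  path follows x (rcons s y) -> all fresh (x :: s) -> uniq (map lab (x :: s)) ->
  uniq (map (f \o src) (x :: rcons s y)) -> f u = f (src x) -> f w = f (src y) ->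
  exists r, [/\ rainbow u r, lend u r = w,
    all (fun z => f z \in map (f \o src) (x :: rcons s y)) (u :: unzip2 r) &
    all (fun j => (j \in map lab (x :: s)) ||
       (if g j is Some b then b \in map (f \o src) (x :: rcons s y) else false)) (unzip1 r)].
Proof.
elim: s x u => [|x' s IH] x u /= pth fr ul ub fu fw.
  have {pth} xy : f (tgt x) = f (src y) by move: pth; rewrite andbT => /eqP.
  have [r1 [R1 e1 n1 l1]] := fg fu.
  have [r2 [R2 e2 n2 l2]] := fg (etrans xy (esym fw)).
  move: fr; rewrite andbT => /andP[/eqP gx bx].
  have xy' : f (src x) != f (src y) by move: ub; rewrite inE andbT.
  exists (r1 ++ (lab x, tgt x) :: r2); split.
  - apply: rainbow_cat => //; first by rewrite e1.
    + move=> i /(allP l1)/eqP gi; rewrite inE negb_or; apply/andP; split.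
        by apply: contraTneq isT => ix; rewrite ix gx in gi.
      apply/negP => /(allP l2)/eqP; rewrite gi => -[]; rewrite fu xy => /eqP.
      by rewrite (negPf xy').
    + by apply/negP => /(allP l2); rewrite gx.
    + move=> z; rewrite inE => zr.
      have {zr} fz : f z = f u by case/orP: zr => [/eqP ->//|/(allP n1)/eqP].
      rewrite inE; apply/negP => zr.
      have : f z = f (tgt x) by case/orP: zr => [/eqP ->//|/(allP n2)/eqP].
      by rewrite fz fu xy => /eqP; rewrite (negPf xy').
  - by rewrite lend_cat /lend /= -/(lend (tgt x) r2).
  - rewrite /unzip2 map_cat /= all_cat /= !inE fu eqxx /= xy eqxx orbT /=.
    apply/andP; split; apply/allP => z.
      by move/(allP n1); rewrite inE fu => ->.
    by move/(allP n2); rewrite !inE xy => ->; rewrite orbT.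
  - rewrite /unzip1 map_cat /= all_cat /= !inE eqxx /=.
    apply/andP; split; apply/allP => j.
      by move/(allP l1)/eqP ->; apply/orP; right; rewrite fu inE eqxx.
    by move/(allP l2)/eqP ->; apply/orP; right; rewrite xy !inE eqxx orbT.
have {pth} [/eqP xy pth] := andP pth.
have [fx fr'] := andP fr; have {fx} [/eqP gx bx] := andP fx.
have [nl ul'] := andP ul; have [nb ub'] := andP ub.
have [r2 [R2 e2 n2 l2]] := IH x' (tgt x) pth fr' ul' ub' xy fw.
have [r1 [R1 e1 n1 l1]] := fg fu.
exists (r1 ++ (lab x, tgt x) :: r2); split.
- apply: rainbow_cat => //; first by rewrite e1.
  + move=> i /(allP l1)/eqP gi; rewrite inE negb_or; apply/andP; split.
      by apply: contraTneq isT => ix; rewrite ix gx in gi.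
    apply/negP => /(allP l2); rewrite gi; case/orP.
      move=> /mapP[z zs iz]; have := allP (fr' : all fresh (x' :: s)) z zs.
      by rewrite /fresh -iz gi.
    by rewrite fu => nb'; rewrite nb' in nb.
  + apply/negP => /(allP l2); rewrite gx orbF => nl'.
    by rewrite nl' in nl.
  + move=> z; rewrite inE => zr.
    have {zr} fz : f z = f u by case/orP: zr => [/eqP ->//|/(allP n1)/eqP].
    by apply/negP => /(allP n2); rewrite fz fu => nb'; rewrite nb' in nb.
- by rewrite lend_cat /lend /= -/(lend (tgt x) r2).
- apply/andP; split; first by rewrite inE fu eqxx.
  rewrite /unzip2 map_cat all_cat; apply/andP; split; apply/allP => z.
    by move/(allP n1)/eqP ->; rewrite inE fu eqxx.
  by move=> zr; have zB := allP n2 z zr; rewrite inE zB orbT.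
- rewrite /unzip1 map_cat /= all_cat /= inE eqxx /=.
  apply/andP; split; apply/allP => j.
    by move/(allP l1)/eqP ->; apply/orP; right; rewrite fu inE eqxx.
  move/(allP l2); case/orP => [jl|]; first by rewrite inE jl orbT.
  by case: (g j) => // b bB; rewrite [b \in _]inE bB !orbT.
Qed.

Section Shortest.
Variable c : seq arrow.
Hypothesis cyc_c : block_cycle c.
Hypothesis c_min : forall c', block_cycle c' -> (size c <= size c')%N.

(** Rotate [x] to the front. A repeated block closes up [x :: s]. For a repeated label, either one
    arrow leads from the source of [x] to the target of [y] and bypasses [s], or the order on the
    path yields an arrow from the source of [y] to the target of [x] that closes up [s]. Each cycle
    is shorter than [c]. *)
Lemma shortest_neq p x s y r : c = p ++ x :: s ++ y :: r ->
  f (src x) <> f (src y) /\ lab x <> lab y.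
Proof.
move=> cE; have : block_cycle (x :: s ++ y :: (r ++ p)).
  have <- : rot (size p) c = x :: s ++ y :: (r ++ p).
    by rewrite cE rot_size_cat /= -catA.
  case/and3P: cyc_c => c0 fr cy; rewrite /block_cycle rot_cycle cy andbT.
  rewrite -size_eq0 size_rot size_eq0 c0 /=.
  by apply/allP => z; rewrite mem_rot => /(allP fr).
have : (size (x :: s ++ y :: (r ++ p)) <= size c)%N.
  by rewrite cE /= !size_cat /= !size_cat /=; clear; lia.
move: (r ++ p) => q {p r cE} szc.
rewrite /block_cycle /= all_cat /= rcons_cat cat_path /= => /and3P[/and4P[fx fs fy fq] ps /andP[ly pq]].
have [gx bx] := andP fx; have [gy by_] := andP fy.
split=> E.
  have : block_cycle (x :: s).
    rewrite /block_cycle /= fx fs /= rcons_path ps /=.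
    by move: ly; rewrite /follows E.
  by move/c_min/(leq_trans szc); rewrite /= size_cat /=; clear; lia.
have [lt1|ge1] := ltnP (pos (lab x) (src x)) (pos (lab x) (tgt y)).
  pose z : arrow := (src x, lab x, tgt y).
  have : block_cycle (z :: q).
    rewrite /block_cycle /= fq andbT /fresh /= gx /=.
    have -> : before (lab x) (src x) (tgt y).
      by case/and3P: bx => ox _ _; case/and3P: by_; rewrite -E /before lt1 ox => _ ->.
    move: pq; rewrite !rcons_path => /andP[pq lq].
    rewrite (@path_follows_tgt z y) // pq /=.
    by move: lq; rewrite /follows (@tgt_last z y).
  by move/c_min/(leq_trans szc); rewrite /= size_cat /=; clear; lia.
pose z : arrow := (src y, lab x, tgt x).
have : block_cycle (z :: s).
  rewrite /block_cycle /= fs andbT /fresh /= gx /=.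
  have -> : before (lab x) (src y) (tgt x).
    case/and3P: bx => ox ox' lx; case/and3P: by_; rewrite -E /before ox' => -> _ ly' /=.
    by apply: ltn_trans lx; apply: leq_trans ge1.
  rewrite rcons_path (@path_follows_tgt z x) // ps /=.
  by move: ly; rewrite /follows (@tgt_last z x).
by move/c_min/(leq_trans szc); rewrite /= size_cat /=; clear; lia.
Qed.

Lemma shortest_uniq_lab : uniq (map lab c).
Proof. by apply: uniq_map_split => p x s y r /shortest_neq[]. Qed.

Lemma shortest_uniq_block : uniq (map (f \o src) c).
Proof. by apply: uniq_map_split => p x s y r /shortest_neq[]. Qed.

(** A one-arrow cycle starts and ends in the same block; the rainbow walk between its ends, closed
    by the fresh label, would be a bridge. *)
Lemma shortest_size : (1 < size c)%N.
Proof.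
case: c cyc_c => [|x [|//]] //; rewrite /block_cycle /= !andbT => /andP[/andP[/eqP gx bx] /eqP xx].
have [s [R1 e1 n1 l1]] := fg (esym xx).
have := no_bridge R1; rewrite e1 => /(_ (lab x)); rewrite bx => H.
suff /H : lab x \notin unzip1 s by [].
by apply/negP => /(allP l1); rewrite gx.
Qed.

Definition merge_blocks b0 v := if f v \in map (f \o src) c then b0 else f v.
Definition merge_labels b0 j :=
  if j \in map lab c then Some b0
  else if g j is Some b then (if b \in map (f \o src) c then Some b0 else Some b) else None.

(** Nodes of the same old block keep their walk. Nodes of two different blocks on the cycle are
    joined by expanding the arc of the cycle between these blocks with [chain_rainbow]. *)
Lemma merge_linked b0 u w : b0 \in map (f \o src) c ->
  merge_blocks b0 u = merge_blocks b0 w -> exists s,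
  [/\ rainbow u s, lend u s = w,
      all (fun z => merge_blocks b0 z == merge_blocks b0 u) (unzip2 s) &
      all (fun j => merge_labels b0 j == Some (merge_blocks b0 u)) (unzip1 s)].
Proof.
move=> b0c; rewrite {1 2}/merge_blocks.
have [uc|uc] := boolP (f u \in _); have [wc|wc] := boolP (f w \in _); last first.
- move=> fuw; have [s [R1 e1 n1 l1]] := fg fuw; exists s; split=> //.
    by apply/allP => z /(allP n1)/eqP fz; rewrite /merge_blocks fz.
  apply/allP => j /(allP l1)/eqP gj; rewrite /merge_labels /merge_blocks gj (negPf uc).
  case: ifP => // /mapP[x xc jx]; case/and3P: cyc_c => _ /allP/(_ x xc)/andP[+ _] _.
  by rewrite -jx gj.
- by move=> uE; rewrite uE b0c in uc.
- by move=> uE; rewrite -uE b0c in wc.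
move=> _.
have mz (s : seq (I * V)) : all (fun z => f z \in map (f \o src) c) (unzip2 s) ->
    all (fun z => merge_blocks b0 z == merge_blocks b0 u) (unzip2 s).
  by move=> H; apply/allP => z /(allP H); rewrite /merge_blocks uc => ->.
have ml (s : seq (I * V)) :
    all (fun j => (j \in map lab c) || (if g j is Some b then b \in map (f \o src) c else false)) (unzip1 s) ->
    all (fun j => merge_labels b0 j == Some (merge_blocks b0 u)) (unzip1 s).
  move=> H; apply/allP => j /(allP H); rewrite /merge_labels /merge_blocks uc.
  by case: ifP => //= _; case: (g j) => // b ->.
have [fuw|fuw] := eqVneq (f u) (f w).
  have [s [R1 e1 n1 l1]] := fg fuw; exists s; split=> //.
    by apply: mz; apply/allP => z /(allP n1)/eqP ->.
  by apply: ml; apply/allP => j /(allP l1)/eqP ->; rewrite uc orbT.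
have [x xc fux] := mapP uc.
have [i s rE] := rot_to xc.
have cmem z : (z \in x :: s) = (z \in c) by rewrite -rE mem_rot.
have /and3P[_ frs cys] : block_cycle (x :: s).
  rewrite -rE /block_cycle rot_cycle -size_eq0 size_rot size_eq0.
  case/and3P: cyc_c => -> fr ->; rewrite andbT /=.
  by apply/allP => z; rewrite mem_rot => /(allP fr).
have ulab : uniq (map lab (x :: s)) by rewrite -rE map_rot rot_uniq shortest_uniq_lab.
have ublk : uniq (map (f \o src) (x :: s)) by rewrite -rE map_rot rot_uniq shortest_uniq_block.
have blkE z : (z \in map (f \o src) (x :: s)) = (z \in map (f \o src) c).
  by rewrite -rE map_rot mem_rot.
have labE z : (z \in map lab (x :: s)) = (z \in map lab c).
  by rewrite -rE map_rot mem_rot.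
have [y] := mapP wc; rewrite -cmem inE => ys fwy.
have {}ys : y \in s.
  case/orP: ys => // /eqP yx; case/negP: fuw; apply/eqP.
  by rewrite fux fwy yx.
move: frs cys ulab ublk blkE labE; case/splitPr: ys => s1 s2 {rE cmem} frs cys ulab ublk blkE labE.
have [||||r [R1 e1 n1 l1]] := @chain_rainbow s1 x y u w _ _ _ _ fux fwy.
- by rewrite rcons_path; move: cys; rewrite /= rcons_cat cat_path /= => /and3P[-> ->].
- by move: frs; rewrite /= all_cat => /and3P[-> ->].
- by move: ulab; rewrite -cat_cons map_cat cat_uniq => /and3P[].
- move: ublk; rewrite -cat_rcons -cat_cons map_cat cat_uniq => /and3P[].
  by [].
have sub z : z \in map (f \o src) (x :: rcons s1 y) -> z \in map (f \o src) c.
  by rewrite -blkE -cat_rcons -cat_cons map_cat mem_cat => ->.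
exists r; split=> //.
  apply: mz; case/andP: n1 => _ n1; apply/allP => z /(allP n1); exact: sub.
apply: ml; apply/allP => j /(allP l1); case/orP => [jl|].
  by rewrite -labE -cat_cons map_cat mem_cat jl.
by case: (g j) => // b /sub ->; rewrite orbT.
Qed.

Lemma merge_card b0 : b0 \in map (f \o src) c ->
  (#|merge_blocks b0 @: [set: V]| + (size c).-1 <= #|f @: [set: V]|)%N /\
  (#|[set j | merge_labels b0 j != None]| <= #|[set j | g j != None]| + size c)%N.
Proof.
move=> b0c; have sc := shortest_size; split.
  pose B := [set b in map (f \o src) c].
  have BV : B \subset f @: [set: V].
    apply/fintype.subsetP => b; rewrite inE => /mapP[x _ ->]; exact: imset_f.
  have cB : #|B| = size c.
    by rewrite cardsE (card_uniqP _) ?size_map // shortest_uniq_block.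
  have sub : merge_blocks b0 @: [set: V] \subset b0 |: (f @: [set: V] :\: B).
    apply/fintype.subsetP => b /imsetP[v _ ->]; rewrite /merge_blocks !inE.
    by case: ifP => [_|vc]; rewrite ?eqxx // vc imset_f ?orbT.
  have := subset_leq_card sub; rewrite cardsU1 cardsD (finset.setIidPr BV) cB.
  have := subset_leq_card BV; rewrite cB.
  move: (b0 \notin _) sc => bb; move: #|_| #|_| (size c) => p q r; case: bb; clear; lia.
pose L0 := [set j in map lab c].
have sub : [set j | merge_labels b0 j != None] \subset [set j | g j != None] :|: L0.
  apply/fintype.subsetP => j; rewrite !inE /merge_labels.
  by case: ifP => [_ _|_]; rewrite ?orbT //; case: (g j).
apply: leq_trans (subset_leq_card sub) _; apply: leq_trans (leq_card_setU _ _) _.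
by rewrite leq_add2l cardsE; apply: leq_trans (card_size _) _; rewrite size_map.
Qed.

End Shortest.

(** Contract a shortest cycle. With [m] arrows it spends at most [m] new labels and removes at least
    [m - 1] blocks; since [m >= 2], spent labels plus twice the blocks does not grow. *)
Lemma merge_cycle (c : seq arrow) : block_cycle c -> exists (f' : V -> V) (g' : I -> option V),
  [/\ forall u w, f' u = f' w -> exists s,
      [/\ rainbow u s, lend u s = w, all (fun z => f' z == f' u) (unzip2 s) &
          all (fun j => g' j == Some (f' u)) (unzip1 s)],
      (#|f' @: [set: V]| < #|f @: [set: V]|)%N &
      (#|[set j | g' j != None]| + 2 * #|f' @: [set: V]| <=
       #|[set j | g j != None]| + 2 * #|f @: [set: V]|)%N].
Proof.
move=> cyc.
have ex : exists n, `[<exists c, block_cycle c /\ size c = n>].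
  by exists (size c); apply/asboolP; exists c.
case: (ex_minnP ex) => n /asboolP[{cyc} c [cyc cn]] nmin.
have c_min c' : block_cycle c' -> (size c <= size c')%N.
  by move=> cyc'; rewrite cn; apply: nmin; apply/asboolP; exists c'.
have sc := shortest_size cyc; case cE : c => [|x c1]; first by rewrite cE in sc.
have b0c : f (src x) \in map (f \o src) c by rewrite cE /= inE eqxx.
exists (merge_blocks c (f (src x))), (merge_labels c (f (src x))).
have [c1le c2le] := merge_card cyc c_min b0c; split.
- by move=> u w; exact: (merge_linked cyc c_min b0c).
- by move: c1le sc; move: #|_| #|_| (size c) => p q r; clear; lia.
- by move: c1le c2le sc; move: #|_| #|_| #|_| #|_| (size c) => p q r p' q'; clear; lia.
Qed.

End Merge.

Definition free_step (K : {set I}) : rel V := fun u v => [exists j, (j \notin K) && before j u v].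

(** Contract as long as unspent labels form a cycle. At the start all blocks are singletons and
    nothing is spent, so the invariant quantity is at most [2 * #|V|] throughout, and it bounds the
    spent labels [K]. *)
Lemma few_labels_acyclic : exists2 K : {set I}, (#|K| <= 2 * #|V|)%N &
  forall u v, free_step K u v -> ~~ connect (free_step K) v u.
Proof.
suff H n f g : linked f g -> (#|f @: [set: V]| <= n)%N ->
    (#|[set j | g j != None]| + 2 * #|f @: [set: V]| <= 2 * #|V|)%N ->
    exists2 K : {set I}, (#|K| <= 2 * #|V|)%N &
      forall u v, free_step K u v -> ~~ connect (free_step K) v u.
  apply: (H #|V| id (fun=> None)).
  - by move=> u w ->; exists [::]; split; rewrite /rainbow //= andbT.
  - by rewrite -cardsT; exact: leq_imset_card.
  - rewrite (eq_card0 (A := [set j | _])) ?add0n; last by move=> j; rewrite inE eqxx.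
    by rewrite leq_mul2l -cardsT leq_imset_card.
elim: n f g => [|n IH] f g fg fn fgb.
  exists finset.set0; first by rewrite cards0.
  move=> u; have : f u \in f @: [set: V] by exact: imset_f.
  by move: fn; rewrite leqn0 cards_eq0 => /eqP ->; rewrite inE.
pose K := [set j | g j != None].
have [ac|] := pselect (forall u v, free_step K u v -> ~~ connect (free_step K) v u).
  by exists K => //; apply: leq_trans fgb; rewrite leq_addr.
move=> nac.
(* Arrows that meet in a node meet in its block, so a cycle of free steps is a block cycle. *)
have [c cyc] : exists c, block_cycle f g c.
  apply: contrapT => nc; apply: nac => u v /existsP[j /andP[jK jb]].
  apply/negP => /connectP[p pth uE]; apply: nc.
  have gj : g j == None by move: jK; rewrite inE negbK.
  have fx : fresh g (u, j, v) by rewrite /fresh gj.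
  have [c [c1 c2 c3]] : exists c, [/\ all (fresh g) c, path (follows f) (u, j, v) c &
      tgt (last (u, j, v) c) = last v p].
    have : tgt (u, j, v) = v by [].
    move: (u, j, v) => x; elim: p v pth {uE fx jb} x => [|z p IHp] v' /=.
      by move=> _ x xv; exists [::].
    case/andP=> /existsP[j' /andP[j'K j'b]] pth x xv.
    have [c [c1 c2 c3]] := IHp z pth (v', j', z) erefl.
    exists ((v', j', z) :: c); split=> //=.
      by rewrite c1 andbT /fresh j'b andbT; move: j'K; rewrite inE negbK.
    by rewrite c2 andbT /follows xv.
  exists ((u, j, v) :: c).
  by rewrite /block_cycle /= fx c1 rcons_path c2 /follows c3 -uE eqxx.
have [f' [g' [fg' lt le]]] := merge_cycle fg cyc.
apply: (IH f' g') => //; first by rewrite -ltnS; apply: leq_trans lt _.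
exact: leq_trans le fgb.
Qed.

Section Ranked.
Variables (A : pred I) (h : V -> nat).
Hypothesis hA : forall j u v, A j -> before j u v -> (h u < h v)%N.

Lemma before_rank j u v : A j -> on j u -> on j v -> (h u < h v)%N -> before j u v.
Proof.
move=> Aj ou ov huv; rewrite /before ou ov /= ltnNge; apply/negP.
rewrite leq_eqVlt => /orP[/eqP/(pos_inj ov ou) vu|lt].
  by rewrite vu ltnn in huv.
by have := @hA j v u Aj; rewrite /before ou ov lt => /(_ isT); rewrite ltnNge ltnW.
Qed.

Lemma lwalk_rank u s : all A (unzip1 s) -> lwalk u s ->
  path (fun a b => (h a < h b)%N) u (unzip2 s).
Proof.
elim: s u => //= -[j x] s IH u /andP[Aj As] /andP[b w].
by rewrite (hA Aj b) IH.
Qed.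

Lemma lend_rank u s : all A (unzip1 s) -> lwalk u s -> s != [::] -> (h u < h (lend u s))%N.
Proof.
case: s => // x s As ws _; have := lwalk_rank As ws.
rewrite (path_sortedE (leT := fun a b => (h a < h b)%N)); last by move=> ? ? ?; apply: ltn_trans.
by case/andP => /allP + _; apply; rewrite /lend /= mem_last.
Qed.

(** Induction on length. If a label [j] repeats, the rank lets a single arrow jump over the stretch
    in between; the shorter walk uses only [i], so [j = i], and the stretch itself has both ends on
    path [i]. If labels are distinct and [i] is absent, the walk is rainbow and [i] closes a bridge.
    If [i] occurs, the walks before and after it have both ends on path [i]. *)
Lemma walk_protected i u s : A i -> all A (unzip1 s) -> lwalk u s ->
  on i u -> on i (lend u s) -> all (pred1 i) (unzip1 s).
Proof.
move=> Ai; have [n] := ubnP (size s); elim: n u s => // n IH u s sn As ws ou ow.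
have [->//|s0] := eqVneq s [::].
have biw : before i u (lend u s) by apply: before_rank => //; apply: lend_rank.
have [ul|nul] := boolP (uniq (unzip1 s)); last first.
  apply: contrapT => nall; case/negP: nul; apply: uniq_map_split => p [j x] q [j' z] r sE /= jj.
  subst j'; apply: nall.
  have -> : all (pred1 i) (unzip1 s) = [&& all (pred1 i) (unzip1 p), j == i,
      all (pred1 i) (unzip1 q), j == i & all (pred1 i) (unzip1 r)].
    by rewrite sE /unzip1 map_cat all_cat /= map_cat all_cat.
  move: As ws ow sn; rewrite sE /unzip1 map_cat /= map_cat /= !all_cat /= all_cat /=.
  move=> /and3P[Ap Aj /and3P[Aq _ Ar]].
  rewrite lwalk_cat /= lwalk_cat /= => /and3P[wp bx /and3P[wq bz wr]] ow sn.
  have hz : before j (lend u p) z.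
    case/and3P: bx (bx) => oa _ _ bx; case/and3P: bz (bz) => _ oz _ bz.
    apply: before_rank => //; apply: ltn_trans (hA Aj bx) _.
    have := hA Aj bz; have [->//|q0] := eqVneq q [::].
    by apply: ltn_trans; apply: lend_rank.
  have : all (pred1 i) (unzip1 (p ++ (j, z) :: r)).
    apply: (IH u).
    - by move: sn; rewrite !size_cat /= size_cat /=; clear; lia.
    - by rewrite /unzip1 map_cat all_cat /= Ap Aj.
    - by rewrite lwalk_cat /= wp hz wr.
    - by [].
    - by move: ow; rewrite !lend_cat /= /lend /= /unzip2 map_cat /= last_cat.
  rewrite /unzip1 map_cat all_cat /= => /and3P[-> /eqP ji ->]; rewrite ji eqxx /= andbT.
  subst j; rewrite -/(unzip1 q); apply: (IH x).
  - by move: sn; rewrite !size_cat /= size_cat /=; clear; lia.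
  - by [].
  - by [].
  - by case/and3P: bx.
  - by case/and3P: bz.
have [il|il] := boolP (i \in unzip1 s); last first.
  suff : rainbow u s by move/no_bridge => /(_ i il); rewrite biw.
  rewrite /rainbow ws ul; apply: (@sorted_uniq _ (fun a b => (h a < h b)%N)).
  - by move=> ? ? ?; apply: ltn_trans.
  - by move=> ?; rewrite ltnn.
  - exact: lwalk_rank.
case/mapP: il => -[j x] xs /= ij; subst j.
move: sn As ws ow ul {s0 biw}; case/splitPr: xs => p r sn.
rewrite /unzip1 map_cat /= all_cat /= => /and3P[Ap _ Ar].
rewrite lwalk_cat /= => /and3P[wp bx wr]; rewrite lend_cat => ow.
rewrite cat_uniq /= => /and3P[up ip ur].
have {}sn : (size p + (size r).+1 <= n)%N by move: sn; rewrite size_cat.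
have pi : all (pred1 i) (unzip1 p).
  apply: (IH u) => //; first by apply: leq_trans sn; rewrite addnS ltnS leq_addr.
  by case/and3P: bx.
have ri : all (pred1 i) (unzip1 r).
  apply: (IH x) => //; first by apply: leq_trans sn; rewrite leq_addl.
  by case/and3P: bx.
by rewrite all_cat /= pi ri eqxx.
Qed.

End Ranked.
End Rainbow.

(** * Random sampling of nodes *)

(** With [e = 1 / (2 * Q)], [(1 - e) ^ Q * (1 + e) ^ Q <= 1] and
    [(1 + e) ^ Q >= 1 + Q * e = 3 / 2]. *)
Lemma bernoulli_half (F : realFieldType) (Q : nat) : (0 < Q)%N ->
  (1 - (2 * Q%:R)^-1) ^+ Q <= 2 / 3 :> F.
Proof.
move=> Q0; have Q0' : 0 < (Q%:R : F) by rewrite ltr0n.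
have Q1 : 1 <= (Q%:R : F) by rewrite (ler_nat _ 1).
set e : F := (2 * Q%:R)^-1.
have e0 : 0 < e by rewrite invr_gt0 mulr_gt0.
have Qe : Q%:R * e = 1 / 2 by rewrite /e; field; rewrite gt_eqF.
have bern n : 1 + n%:R * e <= (1 + e) ^+ n.
  elim: n => [|n IH]; first by rewrite mul0r addr0 expr0.
  rewrite exprS -natr1; have : 0 <= (n%:R : F) by exact: ler0n.
  by move: IH; move: (_ ^+ n) => z; nra.
have e1 : e <= 1 / 2 by rewrite -Qe; nra.
have x0 : 0 <= 1 - e by lra.
have : (1 - e) ^+ Q * (1 + e) ^+ Q <= 1.
  by rewrite -exprMn exprn_ile1 //; nra.
have := bern Q; rewrite Qe; have : 0 <= (1 - e) ^+ Q by rewrite exprn_ge0.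
by move: ((1 - e) ^+ Q) ((1 + e) ^+ Q) => a b; nra.
Qed.

(** Each unit of [m] contributes a factor at most [2 * (2 / 3) ^ 4 < 1 / 2], and [m] is at least
    2. *)
Lemma sample_tail (F : realFieldType) (Q m l : nat) :
  (0 < Q)%N -> (1 < m)%N -> (4 * m * Q <= l)%N ->
  2 ^+ m * (1 - (2 * Q%:R)^-1) ^+ l <= 4^-1 :> F.
Proof.
move=> Q0 m1 lm; have B := bernoulli_half F Q0; set x : F := 1 - _ in B *.
have Q1 : 1 <= (Q%:R : F) by rewrite (ler_nat _ 1).
have i1 : (2 * Q%:R)^-1 <= 1 :> F by rewrite invf_le1; lra.
have i0 : 0 < (2 * Q%:R)^-1 :> F by rewrite invr_gt0; lra.
have x0 : 0 <= x by rewrite /x; lra.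
have x1 : x <= 1 by rewrite /x; lra.
apply: (@le_trans _ _ (2 ^+ m * (2 / 3) ^+ (4 * m))).
  rewrite ler_pM2l ?exprn_gt0 //; apply: (@le_trans _ _ (x ^+ (4 * m * Q))).
    exact: ler_wiXn2l.
  rewrite mulnC exprM; apply: lerXn2r; rewrite ?nnegrE ?exprn_ge0 //; lra.
rewrite exprM -exprMn; apply: (@le_trans _ _ ((1 / 2) ^+ m)).
  by apply: lerXn2r; rewrite ?nnegrE ?mulr_ge0 ?exprn_ge0 //; lra.
apply: (@le_trans _ _ ((1 / 2) ^+ 2)); first by apply: ler_wiXn2l => //; lra.
by lra.
Qed.

(** Keep each node with probability [1 / Q]. By Markov, [A] is too large with probability at most
    [1 / 4]. A set with fewer than [m] kept nodes has [2 ^ (m - hits) >= 1], of mean at most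
    [1 / 4], so more than half of the sets fail with probability at most [1 / 2]. *)
Lemma select_nodes (F : realFieldType) (V J : finType) (B : J -> {set V}) (l Q m : nat) :
  (0 < Q)%N -> (1 < m)%N -> (4 * m * Q <= l)%N -> (0 < #|J|)%N ->
  (forall j, (l <= #|B j|)%N) ->
  exists A : {set V}, (#|A| * Q <= 4 * #|V|)%N /\
    (2 * #|[set j | (#|B j :&: A| < m)%N]| <= #|J|)%N.
Proof.
move=> Q0 m1 lm J0 Bl.
pose k0 : 'I_Q := Ordinal Q0; pose Om := {ffun V -> 'I_Q}.
pose A (f : Om) := [set v | f v == k0].
case: (pickP (fun f : Om => (#|A f| * Q <= 4 * #|V|)%N &&
    (2 * #|[set j | (#|B j :&: A f| < m)%N]| <= #|J|)%N)) => [f /andP[? ?]|none].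
  by exists (A f).
exfalso.
have V0 : (0 < #|V|)%N.
  have [j _] := card_gt0P J0; apply: leq_trans (max_card (mem (B j))).
  by apply: leq_trans (Bl j); apply: leq_trans lm; rewrite !muln_gt0 Q0 (ltnW m1).
have V0' : 0 < (#|V|%:R : F) by rewrite ltr0n.
have J0' : 0 < (#|J|%:R : F) by rewrite ltr0n.
have Q0' : 0 < (Q%:R : F) by rewrite ltr0n.
pose X (f : Om) j := #|B j :&: A f|.
have bad (f : Om) : 1 <= #|A f|%:R * (Q%:R / (4 * #|V|%:R)) +
    2 / #|J|%:R * \sum_j 2 ^+ m * (2^-1) ^+ X f j :> F.
  have s0 : 0 <= \sum_j 2 ^+ m * (2^-1) ^+ X f j :> F.
    by apply: sumr_ge0 => j _; rewrite mulr_ge0 ?exprn_ge0 ?invr_ge0.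
  have /negbT := none f; rewrite negb_and -!ltnNge => /orP[lt|lt].
    apply: (@le_trans _ _ (#|A f|%:R * (Q%:R / (4 * #|V|%:R)))).
      rewrite mulrA ler_pdivlMr ?mulr_gt0 // mul1r -!natrM ler_nat; exact: ltnW.
    by rewrite lerDl mulr_ge0 // divr_ge0 // ltW.
  apply: (@le_trans _ _ (2 / #|J|%:R * #|[set j | (#|B j :&: A f| < m)%N]|%:R)).
    by rewrite mulrAC ler_pdivlMr // mul1r -natrM ler_nat ltnW.
  rewrite -[leLHS]add0r; apply: lerD; first by rewrite mulr_ge0 ?divr_ge0 ?mulr_ge0 ?ler0n.
  rewrite ler_pM2l ?divr_gt0 // -sum1_card natr_sum big_mkcond /=.
  apply: ler_sum => j _; rewrite inE -/(X f j); case: ifP => [Xm|_].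
    rewrite exprVn ler_pdivlMr ?exprn_gt0 // mul1r; apply: ler_weXn2l; rewrite ?(ltnW Xm) //.
    by rewrite (ler_nat _ 1 2).
  by rewrite mulr_ge0 ?exprn_ge0 ?invr_ge0.
have prodE (g : V -> 'I_Q -> F) : \sum_(f : Om) \prod_v g v (f v) = \prod_v \sum_k g v k.
  by rewrite bigA_distr_bigA.
have cOm : #|{: Om}|%:R = Q%:R ^+ #|V| :> F by rewrite card_ffun card_ord natrX.
have sumA : \sum_(f : Om) #|A f|%:R * Q%:R = #|V|%:R * #|{: Om}|%:R :> F.
  transitivity (\sum_v \sum_(f : Om) (f v == k0)%:R * Q%:R : F).
    rewrite exchange_big /=; apply: eq_bigr => f _.
    rewrite -mulr_suml -natr_sum -sum1_card; congr (_%:R * _).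
    by rewrite big_mkcond; apply: eq_bigr => v _; rewrite inE; case: eqP.
  rewrite -sum1_card natr_sum mulr_suml; apply: eq_bigr => v _; rewrite mul1r.
  transitivity (\sum_(f : Om) \prod_w (if w == v then (f w == k0)%:R * Q%:R else 1) : F).
    apply: eq_bigr => f _; rewrite (bigD1 v) //= eqxx big1 ?mulr1 // => w /negPf ->.
    by [].
  rewrite (prodE (fun w k => if w == v then (k == k0)%:R * Q%:R else 1)) cOm -prodr_const; apply: eq_bigr => w _.
  have [_|_] := eqVneq w v; last by rewrite sumr_const card_ord.
  rewrite -mulr_suml (bigD1 k0) //= ?eqxx big1 ?addr0 ?mul1r // => k /negPf ->.
  by [].
have sumX j : \sum_(f : Om) 2 ^+ m * (2^-1) ^+ X f j <= #|{: Om}|%:R * 4^-1 :> F.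
  have -> : \sum_(f : Om) 2 ^+ m * (2^-1) ^+ X f j =
      2 ^+ m * \sum_(f : Om) \prod_v (if (v \in B j) && (f v == k0) then 2^-1 else 1) :> F.
    rewrite mulr_sumr; apply: eq_bigr => f _; congr (_ * _).
    rewrite -big_mkcond /= prodr_const; congr (_ ^+ _).
    by apply: eq_card => v; rewrite !inE.
  rewrite (prodE (fun v k => if (v \in B j) && (k == k0) then 2^-1 else 1)).
  (* A node of [B j] contributes [Q - 1 / 2] and any other node [Q]. *)
  have -> : \prod_v \sum_k (if (v \in B j) && (k == k0) then 2^-1 else 1) =
      #|{: Om}|%:R * (1 - (2 * Q%:R)^-1) ^+ #|B j| :> F.
    have -> : (1 - (2 * Q%:R)^-1) ^+ #|B j| =
        \prod_v (if v \in B j then 1 - (2 * Q%:R)^-1 else 1) :> F.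
      by rewrite -big_mkcond prodr_const.
    have -> : #|{: Om}|%:R = \prod_(v : V) Q%:R :> F by rewrite cOm prodr_const.
    rewrite -big_split /=.
    apply: eq_bigr => v _; case: ifP => vB /=; last by rewrite sumr_const card_ord mulr1.
    rewrite (bigD1 k0) //= ?eqxx (eq_bigr (fun=> 1)) => [|k /negPf ->//].
    rewrite sumr_const; have -> : #|[pred k : 'I_Q | k != k0]| = Q.-1.
      by have := cardC1 k0; rewrite card_ord => <-; apply: eq_card => k; rewrite !inE.
    rewrite -[in RHS](prednK Q0) -[Q.-1.+1%:R]natr1; have : 0 <= (Q.-1%:R : F) by exact: ler0n.
    by move: (Q.-1%:R) => z z0; field; lra.
  rewrite mulrCA ler_pM2l; last by rewrite cOm exprn_gt0.
  apply: le_trans (sample_tail F Q0 m1 lm); rewrite ler_pM2l ?exprn_gt0 //.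
  have Q1 : 1 <= (Q%:R : F) by rewrite (ler_nat _ 1).
  have i1 : (2 * Q%:R)^-1 <= 1 :> F by rewrite invf_le1; lra.
  have i0 : 0 < (2 * Q%:R)^-1 :> F by rewrite invr_gt0; lra.
  by apply: ler_wiXn2l; rewrite ?Bl //; lra.
have tot : #|{: Om}|%:R <= #|{: Om}|%:R * (4^-1 + 2^-1) :> F.
  apply: (@le_trans _ _ (\sum_(f : Om) 1)); first by rewrite sumr_const.
  apply: le_trans (ler_sum _ (fun f _ => bad f)) _.
  rewrite big_split /= mulrDr; apply: lerD.
    under eq_bigr do rewrite mulrA.
    rewrite -mulr_suml sumA ler_pdivrMr ?mulr_gt0 //.
    by rewrite le_eqVlt; apply/orP; left; apply/eqP; field.
  rewrite -mulr_sumr exchange_big /=.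
  apply: (@le_trans _ _ (2 / #|J|%:R * \sum_(j : J) #|{: Om}|%:R * 4^-1)).
    by rewrite ler_pM2l ?divr_gt0 //; apply: ler_sum => j _; exact: sumX.
  rewrite sumr_const -[X in _ * X]mulr_natl mulrA divfK ?gt_eqF //.
  by move: (#|_|%:R : F) => z; lra.
have : 0 < #|{: Om}|%:R :> F by rewrite cOm exprn_gt0.
by move: tot; move: (#|_|%:R : F) => z; lra.
Qed.

(** * From bridge-free path systems to the gap graph *)

Section BridgeFree.
Variables (n : nat) (Pi : seq (seq 'I_n)) (A : {set 'I_n}).
Hypothesis Pi_size : size Pi = n.
Hypothesis Pi_uniq : is_path_system Pi.
Hypothesis Pi_free : bridge_free Pi.

Definition pnth (j : 'I_n) : seq 'I_n := nth [::] Pi j.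
Local Notation V := {v : 'I_n | v \in A}.
Definition visits (j : 'I_n) : pred V := fun v => val v \in pnth j.
Definition rank_on (j : 'I_n) (v : V) : nat := index (val v) (pnth j).
Local Notation vbefore := (before visits rank_on).

Lemma pnth_uniq j : uniq (pnth j).
Proof. by apply: (allP Pi_uniq); rewrite mem_nth // Pi_size. Qed.

Lemma rank_on_inj j u v : visits j u -> visits j v -> rank_on j u = rank_on j v -> u = v.
Proof.
move=> ou ov E; apply: val_inj.
by rewrite -(nth_index (val u) ou) -[RHS](nth_index (val u) ov); congr nth.
Qed.

Lemma lwalk_nth u s j i : lwalk visits rank_on u s -> (i < size s)%N ->
  vbefore (nth j (unzip1 s) i) (nth u (u :: unzip2 s) i) (nth u (unzip2 s) i).
Proof.
elim: s u i => //= -[l x] s IH u [|i] /= /andP[b w]; first by [].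
rewrite ltnS => si; have := IH x i w si.
rewrite (set_nth_default u) /=; last by rewrite size_map ltnW.
by rewrite [nth x (unzip2 s) i](set_nth_default u) // size_map.
Qed.

(** The bridge consists of the nodes of the walk and its labels, with [j] appended as the closing
    path. *)
Lemma no_rainbow_bridge u s j : rainbow visits rank_on u s -> j \notin unzip1 s ->
  ~~ vbefore j u (lend u s).
Proof.
case/and3P => ws ul un js; apply/negP => bj; apply: (Pi_free (b := (size s).+1)).
have sz1 : size (rcons (unzip1 s) j) = (size s).+1 by rewrite size_rcons size_map.
have sz2 : size (u :: unzip2 s) = (size s).+1 by rewrite /= size_map.
exists (fun i => val (nth u (u :: unzip2 s) i)), (fun i => nat_of_ord (nth j (rcons (unzip1 s) j) i)).
split=> //; split.
- move=> i i' /val_inj/eqP; rewrite nth_uniq ?sz2 ?ltn_ord // => /eqP; exact: val_inj.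
- move=> i i' /val_inj/eqP; rewrite nth_uniq ?sz1 ?ltn_ord ?rcons_uniq ?js // => /eqP; exact: val_inj.
- by move=> i; rewrite Pi_size.
- move=> i i' ii; have si : (i < size s)%N by have := ltn_ord i'; rewrite ii.
  rewrite nth_rcons size_map si ii /=; exact: (lwalk_nth j ws si).
- move=> i0 il -> -> /=; rewrite nth_rcons size_map ltnn eqxx.
  by move: bj; rewrite /lend (last_nth u) size_map.
Qed.

(** Once the steps are acyclic, the number of ancestors of a node is a rank that increases along
    every remaining path, as [walk_protected] requires. *)
Lemma protected_labels : exists K : {set 'I_n}, (#|K| <= 2 * #|A|)%N /\
  forall i u s, i \notin K -> all (fun j => j \notin K) (unzip1 s) ->
  lwalk visits rank_on u s -> visits i u -> visits i (lend u s) ->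
  all (pred1 i) (unzip1 s).
Proof.
have [K Kc ac] := few_labels_acyclic no_rainbow_bridge.
exists K; split; first by rewrite card_sig in Kc.
pose fs := free_step visits rank_on K.
pose h v := #|[set u | connect fs u v]|.
have hK j u v : j \notin K -> vbefore j u v -> (h u < h v)%N.
  move=> jK b; have uv : fs u v by apply/existsP; exists j; rewrite jK.
  apply: proper_card; apply/properP; split.
    by apply/fintype.subsetP => z; rewrite !inE => zu; exact: connect_trans zu (connect1 uv).
  by exists v; rewrite !inE ?connect0 // ac.
move=> i u s iK sK; exact: (walk_protected rank_on_inj no_rainbow_bridge (A := fun j => j \notin K) hK iK sK).
Qed.

Variables (d : nat) (J : {set 'I_n}) (K : {set 'I_n}) (v0 : V).
Hypothesis protK : forall i u s, i \notin K -> all (fun j => j \notin K) (unzip1 s) ->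
  lwalk visits rank_on u s -> visits i u -> visits i (lend u s) ->
  all (pred1 i) (unzip1 s).
Hypothesis J_long : forall j, j \in J -> (d <= #|[set v in pnth j] :&: A|)%N.

Local Notation I := {j : 'I_n | j \in J :\: K}.
Definition kept (j : 'I_n) : seq 'I_n := [seq v <- pnth j | v \in A].
(** Truncation to [d] surviving nodes gives all paths the common length of the gap graph; [v0] is a
    default value. *)
Definition track (i : I) (t : 'I_d) : V := insubd v0 (nth (val v0) (kept (val i)) t).

Lemma size_kept (i : I) : (d <= size (kept (val i)))%N.
Proof.
have := valP i; rewrite /= !inE => /andP[_ /J_long]; congr (_ <= _)%N.
rewrite cardE; apply: perm_size; apply: uniq_perm; rewrite ?enum_uniq ?filter_uniq ?pnth_uniq //.
by move=> v; rewrite mem_enum !inE mem_filter andbC.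
Qed.

Lemma val_track i t : val (track i t) = nth (val v0) (kept (val i)) t.
Proof.
rewrite /track insubdK //.
have : nth (val v0) (kept (val i)) t \in kept (val i).
  by rewrite mem_nth //; apply: leq_trans (size_kept i); exact: ltn_ord.
by rewrite mem_filter => /andP[].
Qed.

Lemma track_before (i : I) (t t' : 'I_d) : (t < t')%N -> vbefore (val i) (track i t) (track i t').
Proof.
move=> tt; have lt (x : 'I_d) : (x < size (kept (val i)))%N.
  by apply: leq_trans (size_kept i); exact: ltn_ord.
have mem (x : 'I_d) : val (track i x) \in pnth (val i).
  by have := mem_nth (val v0) (lt x); rewrite -val_track mem_filter => /andP[].
rewrite /before /visits !mem /= /rank_on !val_track.
pose le := fun a b => (index a (pnth (val i)) < index b (pnth (val i)))%N.
have letr : transitive le by move=> ? ? ?; apply: ltn_trans.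
have srt : sorted le (kept (val i)).
  apply: sorted_filter => //; apply/(sortedP (val v0)) => x xs.
  by rewrite /le !index_uniq ?pnth_uniq // ltnW.
exact: (sorted_ltn_nth letr (val v0) srt _ _ (lt t) (lt t') tt).
Qed.

Lemma track_inj i : injective (track i).
Proof.
move=> t t' E; apply/val_inj/eqP; case: ltngtP => // /(track_before i) /and3P[_ _];
  by rewrite E ltnn.
Qed.

Lemma on_track i v : on_path track i v -> visits (val i) v.
Proof.
case/existsP => t /eqP <-.
have := mem_nth (val v0) (leq_trans (ltn_ord t) (size_kept i)).
by rewrite -val_track mem_filter => /andP[].
Qed.

Lemma label_notin (i : I) : val i \notin K.
Proof. by have := valP i; rewrite /= inE => /andP[]. Qed.

Lemma track_label_unique i j (t t' : 'I_d) : (t < t')%N ->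
  on_path track i (track j t) -> on_path track i (track j t') -> j = i.
Proof.
move=> tt /on_track o1 /on_track o2; apply: val_inj.
have a : all (fun j => j \notin K) (unzip1 [:: (val j, track j t')]) by rewrite /= label_notin.
have w : lwalk visits rank_on (track j t) [:: (val j, track j t')] by rewrite /= track_before.
by have := protK (label_notin i) a w o1 o2; rewrite /= andbT => /eqP.
Qed.

Lemma track_connect u v : connect (path_step track) u v ->
  exists s, [/\ all (fun j => j \notin K) (unzip1 s), lwalk visits rank_on u s & lend u s = v].
Proof.
case/connectP => p; elim: p u => [|z p IH] u /=; first by move=> _ ->; exists [::].
case/andP => /existsP[j /existsP[t /existsP[t' /and3P[tt /eqP <- /eqP zE]]]] pth vE.
have [s [s1 s2 s3]] := IH z pth vE.
by exists ((val j, z) :: s); split; rewrite /= ?label_notin // s2 andbT -zE track_before.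
Qed.

(** With the last step appended, the connecting walk has both ends on path [i]; protection makes its
    final label [i]. *)
Lemma track_no_return i u v v' : on_path track i u -> connect (path_step track) u v ->
  path_step track v v' -> on_path track i v' -> on_path track i v.
Proof.
move=> /on_track ou /track_connect[s [s1 s2 s3]].
case/existsP => j /existsP[t /existsP[t' /and3P[tt /eqP vE /eqP <-]]] /on_track ov'.
pose s' := s ++ [:: (val j, track j t')].
have a : all (fun j => j \notin K) (unzip1 s') by rewrite /unzip1 map_cat all_cat s1 /= label_notin.
have w : lwalk visits rank_on u s' by rewrite lwalk_cat s2 /= s3 -vE track_before.
have e : visits (val i) (lend u s') by rewrite lend_cat.
have := protK (label_notin i) a w ou e.
rewrite /unzip1 map_cat all_cat /= => /and3P[_ /eqP ji _].
by apply/existsP; exists t; rewrite -(val_inj ji : j = i) vE.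
Qed.

End BridgeFree.

(** Sampling gives [#|A| <= #|J| / 8] while half of the paths keep [2 * L] nodes. Discarding
    [2 * #|A| <= #|J| / 4] labels then leaves at least a quarter of [J]. *)
Lemma gap_of_bridge_free (R : realType) (n N k l Q L : nat) (Pi : seq (seq 'I_n)) (J : {set 'I_n}) :
  size Pi = n -> is_path_system Pi -> bridge_free Pi ->
  (forall j, j \in J -> (l <= size (pnth Pi j))%N) ->
  (0 < L)%N -> (0 < Q)%N -> (8 * L * Q <= l)%N -> (0 < #|J|)%N ->
  (32 * n <= Q * #|J|)%N -> (#|J| <= 4 ^ L)%N -> (gap_const * (#|J| * L) <= N)%N ->
  SCG_bound R N k -> (L <= gap_const * k)%N.
Proof.
move=> sP uP fP Jl L0 Q0 QL J0 nQ J4 JN kb.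
pose Bf (j : {j | j \in J}) := [set v in pnth Pi (val j)].
have cB j : #|Bf j| = size (pnth Pi (val j)).
  by rewrite cardsE; apply/card_uniqP; exact: pnth_uniq.
have cJ : #|{: {j | j \in J}}| = #|J| by rewrite card_sig.
have [] := @select_nodes R _ _ Bf l Q (2 * L) Q0 _ _ _ _.
- by lia.
- by move: QL; clear; lia.
- by rewrite cJ.
- by move=> j; rewrite cB; apply: Jl; exact: (valP j).
move=> A [AQ Abad]; rewrite card_ord in AQ; rewrite cJ in Abad.
have n0 : (0 < n)%N.
  by have [j _] := card_gt0P J0; apply: leq_ltn_trans (ltn_ord j).
have A8 : (8 * #|A| <= #|J|)%N.
  move: AQ nQ n0 J0 Q0; move: #|A| #|J| => a q; clear.
  by move=> *; nia.
have [K [Kc prot]] := protected_labels A sP fP.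
pose J1 := [set j in J | (2 * L <= #|[set v in pnth Pi j] :&: A|)%N].
have cJ1 : (#|J| <= 2 * #|J1|)%N.
  have : (#|J :\: J1| <= #|[set j | (#|Bf j :&: A| < 2 * L)%N]|)%N.
    rewrite -(card_imset _ val_inj); apply: subset_leq_card; apply/fintype.subsetP => j.
    rewrite !inE negb_and => /andP[+ jJ]; rewrite jJ /= -ltnNge => lt.
    by apply/imsetP; exists (exist _ j jJ); rewrite ?inE.
  have J1J : J1 \subset J by apply/fintype.subsetP => j; rewrite inE => /andP[].
  rewrite cardsD (finset.setIidPr J1J); have := subset_leq_card J1J.
  by move: Abad; move: #|J| #|J1| #|[set j | _]| => p q r; clear; lia.
pose I := {j : 'I_n | j \in J1 :\: K}.
have cI : #|{: I}| = #|J1 :\: K| by rewrite card_sig.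
have IJ : (#|{: I}| <= #|J|)%N.
  rewrite cI; apply: subset_leq_card; apply/fintype.subsetP => j.
  by rewrite !inE => /and3P[].
have Ige : (#|J| <= 4 * #|{: I}|)%N.
  rewrite cI cardsD; have : (#|J1 :&: K| <= #|K|)%N by apply: subset_leq_card; exact: subsetIr.
  by move: Kc A8 cJ1; move: #|K| #|A| #|J| #|J1| #|J1 :&: K| => a b c e f; clear; lia.
have J1l j : j \in J1 -> (2 * L <= #|[set v in pnth Pi j] :&: A|)%N by rewrite inE => /andP[].
have I0 : (0 < #|{: I}|)%N by move: Ige J0; move: #|_| #|_| => a b; clear; lia.
have [v0 _] : exists v0 : {v | v \in A}, true.
  have [i _] := card_gt0P I0; have := valP i; rewrite /= !inE => /andP[_ /andP[_ Li]].
  have /card_gt0P[v] : (0 < #|[set v in pnth Pi (val i)] :&: A|)%N by apply: leq_trans Li; lia.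
  by rewrite inE => /andP[_ vA]; exists (exist _ v vA).
apply: (@gap_theorem R I {v | v \in A} (2 * L) L N k (@track _ Pi A _ J1 K v0)
  erefl L0 I0 _ _ _ _ _ _ kb).
- by apply: leq_trans J4.
- by rewrite card_sig; move: A8 Ige; move: #|A| #|J| #|{: I}| => a b c; clear; lia.
- exact: track_inj.
- exact: track_label_unique.
- exact: track_no_return.
- by apply: leq_trans JN; rewrite leq_mul2l leq_mul2r IJ !orbT.
Qed.

(** * Length classes and choice of parameters *)

(** With [a = m.+1] and [q = k %/ a]: [G * k ^ m <= G * a ^ m * q.+1 ^ m <= q.+1 ^ a <= 2 ^ (q * a)
    <= 2 ^ k]. *)
Lemma poly_le_exp2 (G m : nat) : exists k0, forall k, (k0 <= k)%N -> (G * k ^ m <= 2 ^ k)%N.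
Proof.
exists (m.+1 * (G * m.+1 ^ m))%N => k kk.
set a := m.+1 in kk *; set q := (k %/ a)%N.
have qG : (G * a ^ m <= q.+1)%N.
  by apply: leqW; rewrite /q leq_divRL // mulnC.
have ka : (k <= a * q.+1)%N by rewrite ltnW // mulnC ltn_ceil.
apply: (@leq_trans (q.+1 ^ a)).
  apply: (@leq_trans (G * (a * q.+1) ^ m)).
    by rewrite leq_mul2l; case: (m) => [|m']; rewrite ?expn0 ?leqnn ?orbT // leq_exp2r // ka orbT.
  by rewrite expnMn mulnA /a expnS leq_mul2r qG orbT.
apply: (@leq_trans ((2 ^ q) ^ a)).
  by rewrite leq_exp2r // ltn_expl.
by rewrite -expnM leq_exp2l // /q leq_trunc_div.
Qed.

Lemma max_ge_average (k : nat) (w : 'I_k.+1 -> nat) :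
  exists s, (\sum_t w t <= k.+1 * w s)%N.
Proof.
case: (@arg_maxnP _ ord0 xpredT w isT) => s _ smax; exists s.
rewrite -[k.+1 in leqRHS]card_ord -sum_nat_const; apply: leq_sum => t _; exact: smax.
Qed.

Section PathSystems.
Variable n : nat.
Implicit Types Pi : seq (seq 'I_n).

Lemma ps_size_sum Pi : size Pi = n -> ps_size Pi = (\sum_(j < n) size (pnth Pi j))%N.
Proof.
move=> sP; rewrite /ps_size sumnE big_map (big_nth [::]) sP big_mkord.
by apply: eq_bigr.
Qed.

Lemma pnth_size Pi (j : 'I_n) : size Pi = n -> is_path_system Pi -> (size (pnth Pi j) <= n)%N.
Proof.
move=> sP uP; have /card_uniqP <- := pnth_uniq sP uP j.
by apply: leq_trans (max_card _) _; rewrite card_ord.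
Qed.

(** The maximum exists: sizes are at most [n * n], and the [n] one-node paths contain no ordered
    pair, hence no bridge. *)
Lemma beta_infP : (exists Pi : seq (seq 'I_n),
    [/\ is_path_system Pi, size Pi = n, bridge_free Pi & ps_size Pi = beta_inf n n]) /\
  (n <= beta_inf n n)%N.
Proof.
set P := fun m => exists Pi : seq (seq 'I_n),
    [/\ is_path_system Pi, size Pi = n, bridge_free Pi & ps_size Pi = m].
have Pub m : P m -> (m <= n * n)%N.
  move=> [Pi [uP sP _ <-]]; rewrite (ps_size_sum sP).
  apply: (@leq_trans (\sum_(j < n) n)%N); last by rewrite sum_nat_const card_ord.
  by apply: leq_sum => j _; exact: pnth_size.
have Pn : P n.
  pose Pi : seq (seq 'I_n) := [seq [:: j] | j <- enum 'I_n].
  have sP : size Pi = n by rewrite size_map size_enum_ord.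
  have one (q : nat) : (size (nth [::] Pi q) <= 1)%N.
    have [lt|ge] := ltnP q (size Pi); last by rewrite nth_default.
    by have /mapP[j _ ->] := mem_nth [::] lt.
  have nprec (pi : seq 'I_n) x y : (size pi <= 1)%N -> prec pi x y = false.
    case: pi => [|z [|]] //= _; rewrite /prec !inE.
    by case: eqP => //= ->; case: eqP => //= ->; rewrite ltnn.
  exists Pi; split=> //.
  - by apply/allP => s /mapP[j _ ->].
  - move=> [|b] [v [q [b0 [_ _ _ _]]]] //.
    by move=> /(_ ord0 ord_max erefl erefl); rewrite nprec // one.
  - rewrite /ps_size -map_comp (eq_map (g := fun=> 1%N)) // -/(nseq _ _).
    by rewrite sumnE big_map sum1_size size_enum_ord.
by have [[Pi PiP] Pmax] := greatest_natP (ex_intro _ _ Pn) Pub; split; [exists Pi|exact: Pmax].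
Qed.

Lemma length_class Pi : size Pi = n -> is_path_system Pi -> (0 < ps_size Pi)%N ->
  exists (s : nat) (J : {set 'I_n}),
  [/\ forall j, j \in J -> (2 ^ s <= size (pnth Pi j))%N,
      (ps_size Pi <= (trunc_log 2 n).+1 * (#|J| * 2 ^ s.+1))%N &
      (#|J| * 2 ^ s <= ps_size Pi)%N].
Proof.
move=> sP uP; set k := trunc_log 2 n; rewrite (ps_size_sum sP) => P0.
pose len (j : 'I_n) := size (pnth Pi j).
have lek j : (trunc_log 2 (len j) < k.+1)%N.
  by rewrite ltnS; apply: leq_trunc_log; exact: pnth_size.
pose cl j : 'I_k.+1 := Ordinal (lek j).
(* As [trunc_log 2 0 = 0], empty paths have to be excluded from class 0 explicitly. *)
pose J (s : 'I_k.+1) := [set j | (0 < len j)%N && (cl j == s)].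
have [s smax] := max_ge_average (fun s => \sum_(j in J s) len j)%N.
have Js j : j \in J s -> (2 ^ s <= len j < 2 ^ s.+1)%N.
  rewrite inE => /andP[l0 /eqP <-]; exact: trunc_log_bounds.
exists s, (J s); split=> [j /Js /andP[]//||].
  have -> : (\sum_(j < n) size (pnth Pi j) = \sum_s \sum_(j in J s) len j)%N.
    rewrite (bigID (fun j => 0 < len j)%N) /= [X in (_ + X)%N]big1 ?addn0; last first.
      by move=> j; rewrite lt0n negbK => /eqP.
    rewrite (partition_big cl xpredT) //=; apply: eq_bigr => t _.
    by apply: eq_bigl => j; rewrite inE.
  apply: leq_trans smax _; rewrite leq_mul2l -sum_nat_const; apply/orP; right.
  by apply: leq_sum => j /Js /andP[_ /ltnW].
rewrite -sum_nat_const; apply: (@leq_trans (\sum_(j in J s) len j)%N).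
  by apply: leq_sum => j /Js /andP[].
by rewrite big_mkcond; apply: leq_sum => j _; case: ifP.
Qed.

End PathSystems.

(** If [beta_inf] is of order at most [n * log n ^ 2], a gap of order [log n] suffices and the lines
    supply it. Otherwise the heaviest length class gives [L] of order at least
    [beta_inf / (n * log n)]. *)
Lemma beta_le_SCG (R : realType) : exists C k0 : nat, (0 < C)%N /\
  forall n, (0 < n)%N -> (k0 <= trunc_log 2 n)%N ->
  (beta_inf n n <= C * (n * trunc_log 2 n * SCG R (beta_inf n n)))%N.
Proof.
set G := gap_const; pose C4 := (G + 32)%N.
have [k1 k1P] := poly_le_exp2 64 6; have [k2 k2P] := poly_le_exp2 (G * 64) 7.
exists (96 * C4.+1 * G.+1)%N, (maxn 1 (maxn k1 k2)); split; first by [].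
move=> n n0; set k := trunc_log 2 n; rewrite !geq_max => /and3P[k1' kk1 kk2].
have [[Pi [uP sP fP bE]] nb] := beta_infP n.
set b := beta_inf n n in bE nb *; set S := SCG R b.
have kn : (2 ^ k <= n)%N by exact: trunc_logP.
have nk : (n < 2 ^ k.+1)%N by exact: trunc_log_ltn.
have Sb : SCG_bound R b S by exact: SCG_boundP.
have [small|large] := leqP b (16 * C4.+1 * (k.+1 * k.+2) * n).
  have kS : (k <= G * S)%N.
    apply: (gap_of_lines k1' _ _ Sb).
      rewrite expnMn; apply: leq_trans (k1P k kk1) _; exact: leq_exp2r.
    rewrite expnMn -mulnA -expnSr mulnA; apply: leq_trans (k2P k kk2) _.
    exact: leq_trans kn nb.
  apply: leq_trans small _.
  have : (k.+1 * k.+2 <= 6 * (k * k))%N by move: k1'; clear; nia.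
  move: (k.+1 * k.+2)%N => K HK.
  apply: (@leq_trans (16 * C4.+1 * (6 * (k * (G * S))) * n)).
    by rewrite leq_mul2r leq_mul2l; apply/orP; right; apply/orP; right; nia.
  by move: C4.+1 => c; clear; nia.
have b0 : (0 < ps_size Pi)%N by rewrite bE; apply: leq_trans nb.
have [s [J [Jl Jb bJ]]] := length_class sP uP b0; rewrite bE -/k in Jb bJ.
set l := (2 ^ s)%N in Jl Jb bJ; rewrite expnS -/l in Jb.
set q := #|J| in Jb bJ *.
have q0 : (0 < q)%N.
  rewrite lt0n; apply: contraTneq nb => q0; rewrite -ltnNge.
  by move: Jb; rewrite q0 mul0n muln0 leqn0 => /eqP ->.
have qn : (q <= n)%N by apply: leq_trans (max_card _) _; rewrite card_ord.
(* The constant [C4 = G + 32] serves twice: [32 * n <= Q * q] is needed for sampling, and [G <= Q]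
   makes the gap graph fit into [b] nodes. *)
pose Q := ((C4 * n) %/ q).+1; pose L := (l %/ (8 * Q))%N.
have Qq : (C4 * n <= Q * q)%N by rewrite ltnW // /Q ltn_ceil.
have qQ : (Q * q <= C4.+1 * n)%N.
  rewrite /Q mulSn [(C4.+1 * n)%N]mulSn leq_add //; exact: leq_trunc_div.
have lL : (l < 8 * Q * L.+1)%N by rewrite /L mulnC ltn_ceil.
have bL : (b < 16 * C4.+1 * (k.+1 * L.+1) * n)%N.
  apply: leq_ltn_trans Jb _; apply: (@leq_trans (k.+1 * (q * (2 * (8 * Q * L.+1))))).
    by rewrite ltn_mul2l /= ltn_mul2l q0 /= ltn_mul2l.
  apply: (@leq_trans (16 * (k.+1 * L.+1) * (Q * q))); first by apply: eq_leq; ring.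
  apply: (@leq_trans (16 * (k.+1 * L.+1) * (C4.+1 * n))); first by rewrite leq_mul2l qQ orbT.
  by apply: eq_leq; ring.
(* Here the largeness of [b] enters: [L] exceeds the binary logarithm of [n], so
   [q <= n <= 4 ^ L]. *)
have kL : (k.+2 < L.+1)%N.
  have := ltn_trans large bL; rewrite ltn_mul2r => /andP[_].
  by rewrite ltn_mul2l => /andP[_]; rewrite ltn_mul2l => /andP[].
have L0 : (0 < L)%N by move: kL; clear; lia.
have LS : (L <= G * S)%N.
  apply: (gap_of_bridge_free sP uP fP Jl L0 (Q := Q) _ _ q0 _ _ _ Sb).
  - by [].
  - by rewrite mulnAC mulnC /L; apply: leq_trans (leq_trunc_div _ _).
  - by apply: leq_trans Qq; rewrite leq_mul2r /C4 leq_addl orbT.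
  - apply: leq_trans qn _; apply: leq_trans (ltnW nk) _.
    by rewrite -[4%N]/(2 ^ 2)%N -expnM leq_exp2l //; move: kL; clear; lia.
  - apply: leq_trans bJ; rewrite mulnCA leq_mul2l; apply/orP; right.
    have GQ : (G <= Q)%N.
      apply: (@leq_trans C4); first by rewrite /C4 leq_addr.
      by rewrite -(leq_pmul2r q0); apply: leq_trans Qq; rewrite leq_mul2l qn orbT.
    apply: leq_trans (leq_trunc_div l (8 * Q)); rewrite mulnC leq_mul2l.
    by apply/orP; right; apply: leq_trans GQ _; rewrite leq_pmull.
apply: leq_trans (ltnW bL) _.
have : (k.+1 * L.+1 <= 6 * (k * (G * S)))%N.
  apply: (@leq_trans ((2 * k) * (3 * (G * S)))); last by apply: eq_leq; ring.
  by apply: leq_mul; move: k1' L0 LS; clear; lia.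
move: (k.+1 * L.+1)%N => K HK.
apply: (@leq_trans (16 * C4.+1 * (6 * (k * (G * S))) * n)).
  by rewrite leq_mul2r leq_mul2l HK !orbT.
by move: C4.+1 => c; clear; nia.
Qed.

Theorem theorem5p15 (R : realType) :
  exists c : R, 0 < c /\
  exists n0 : nat, forall n : nat, (0 < n)%N -> (n0 <= n)%N ->
    c * ((beta_inf n n)%:R / (n%:R * ln (n%:R : R))) <= ((SCG R (beta_inf n n))%:R : R).
Proof.
have [C [k0 [C0 H]]] := beta_le_SCG R.
have ln2 : 0 < ln (2 : R) by rewrite ln_gt0 // ltr1n.
have C0' : 0 < (C%:R : R) by rewrite ltr0n.
(* The factor [ln 2] converts the binary logarithm to the natural one. *)
exists (ln 2 / C%:R); split; first by rewrite divr_gt0.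
(* The successor makes [trunc_log 2 n] positive, and with it [ln n%:R]. *)
exists (2 ^ k0.+1)%N => n n0 nk.
set b := beta_inf n n; set S := SCG R b.
have k0n : (k0.+1 <= trunc_log 2 n)%N by exact: trunc_log_max.
have := H n n0 (ltnW k0n); rewrite -/b -/S; set k := trunc_log 2 n => bS.
have n0' : 0 < (n%:R : R) by rewrite ltr0n.
have kn : k%:R * ln 2 <= ln (n%:R : R).
  rewrite mulr_natl -lnXn // ler_ln ?posrE ?exprn_gt0 // -natrX ler_nat.
  exact: trunc_logP.
have k0' : 0 < (k%:R : R) by rewrite ltr0n; apply: leq_trans k0n.
have ln0 : 0 < ln (n%:R : R) by apply: lt_le_trans kn; rewrite mulr_gt0.
rewrite mulrA ler_pdivrMr ?mulr_gt0 // mulrAC ler_pdivrMr //.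
have bS' : (b%:R : R) <= C%:R * (n%:R * k%:R * S%:R) by rewrite -!natrM ler_nat.
apply: (@le_trans _ _ (ln 2 * (C%:R * (n%:R * k%:R * S%:R)))); first by rewrite ler_pM2l.
have -> : ln 2 * (C%:R * (n%:R * k%:R * S%:R)) = (n%:R * S%:R * C%:R) * (k%:R * ln 2) :> R by ring.
have -> : S%:R * (n%:R * ln n%:R) * C%:R = (n%:R * S%:R * C%:R) * ln n%:R :> R by ring.
by apply: ler_wpM2l => //; rewrite !mulr_ge0.
Qed.
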